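(* Let $k$ be a field of characteristic zero and let $H:\ 1, h_1=r, h_2, \dots, h_e, h_{e+1}=0$ be an $O$-sequence (the Hilbert function of some standard graded artinian $k$-algebra in $r$ variables). Let $t$ be the smallest integer such that $h_t \le t$. Then all standard graded artinian $k$-algebras $A=k[x_1,\dots,x_r]/I$ having Hilbert function $H$ enjoy the Strong Lefschetz Property if and only if either (i) $r=2$; or (ii) $r>2$, $h_t\le 2$, and for all indices $i=1,2,\dots,t-1$ we have $h_{i-1}=((h_i)_{(i)})^{-1}_{-1}$.
   Context: $R=k[x_1,\dots,x_r]$ is the standard graded polynomial ring ($\deg x_i=1$) over a field $k$ of characteristic zero; a standard graded algebra is $A=R/I$ with $I$ a homogeneous ideal, and its Hilbert function is $H(A,d)=\dim_k A_d$; $A$ is artinian if its Hilbert function is eventually $0$. An $O$-sequence is a sequence that occurs as the Hilbert function of a standard graded $k$-algebra (characterized by Macaulay's theorem). A ''general'' linear form is one whose coefficients lie in a suitable nonempty Zariski-open subset of $k^r$. $A$ has the Strong Lefschetz Property (SLP) if for every $d\ge 1$ and a general linear form $L$, the multiplication map $\times L^d: A_i\to A_{i+d}$ has maximal rank (is injective or surjective) for all $i\ge 0$. Notation: for positive integers $n,d$, the $d$-binomial expansion of $n$ is the unique expression $n=\binom{n_d}{d}+\binom{n_{d-1}}{d-1}+\cdots+\binom{n_j}{j}$ with $n_d>n_{d-1}>\dots>n_j\ge j\ge 1$; then $(n_{(d)})^{-1}_{-1}=\binom{n_d-1}{d-1}+\binom{n_{d-1}-1}{d-2}+\cdots+\binom{n_j-1}{j-1}$,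 with the convention $\binom{m}{n}=0$ if $m<n$ or $n<0$.
   Formalization: The number of variables r is assumed to be at least 2: for r ≤ 1 every such algebra has the SLP (e.g. k[x]/(x^2), with H: 1,1,0) although neither (i) nor (ii) holds, so the equivalence as written fails there. *)

(* Defs.v *)
From HB Require Import structures.
From mathcomp Require Import all_boot all_order all_algebra.
From mathcomp Require Import mpoly.
Set Implicit Arguments. Unset Strict Implicit. Unset Printing Implicit Defensive.
Import Order.TTheory GRing.Theory.
Local Open Scope ring_scope.

(* R = k[x_1,...,x_r] is {mpoly k[r]}; x_{i+1} is 'X_i. *)

(* p is homogeneous of degree d (0 is homogeneous of every degree). *)
Definition homog_deg (k : fieldType) (r d : nat) (p : {mpoly k[r]}) : Prop :=
  p \is ishomog1 d mdeg.

Definition hcomp (k : fieldType) (r d : nat) (p : {mpoly k[r]}) : {mpoly k[r]} :=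
  \sum_(m <- msupp p | mdeg m == d) p@_m *: 'X_[m].

Definition is_ideal (k : fieldType) (r : nat) (I : {mpoly k[r]} -> Prop) : Prop :=
  [/\ I 0,
      (forall p q, I p -> I q -> I (p + q)) &
      (forall p q, I q -> I (p * q))].

Definition homog_ideal (k : fieldType) (r : nat) (I : {mpoly k[r]} -> Prop) : Prop :=
  is_ideal I /\ (forall p d, I p -> I (hcomp d p)).

Definition indep_mod (k : fieldType) (r n : nat) (I : {mpoly k[r]} -> Prop)
  (f : 'I_n -> {mpoly k[r]}) : Prop :=
  forall c : 'I_n -> k, I (\sum_(j < n) c j *: f j) -> forall j, c j = 0.

(* hilb I d h  :<->  H(R/I, d) = dim_k (R/I)_d = dim_k R_d/I_d = h, i.e. h is the
   maximal number of degree-d forms whose images in R/I are linearly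
   independent. *)
Definition hilb (k : fieldType) (r : nat) (I : {mpoly k[r]} -> Prop) (d h : nat) : Prop :=
  (exists f : 'I_h -> {mpoly k[r]}, (forall j, homog_deg d (f j)) /\ indep_mod I f) /\
  (forall f : 'I_h.+1 -> {mpoly k[r]}, (forall j, homog_deg d (f j)) -> ~ indep_mod I f).

Definition linform (k : fieldType) (r : nat) (v : 'I_r -> k) : {mpoly k[r]} :=
  \sum_(i < r) v i *: 'X_i.

(* A property P of linear forms (given by their coefficient vectors) holds for a
   general linear form: it holds on a nonempty Zariski-open subset of k^r, i.e.
   on some nonempty basic open set D(p) = {v | p(v) <> 0}. *)
Definition general (k : fieldType) (r : nat) (P : ('I_r -> k) -> Prop) : Prop :=
  exists p : {mpoly k[r]}, (exists v, p.@[v] != 0) /\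
                           (forall v, p.@[v] != 0 -> P v).

(* The multiplication map  x F : A_i -> A_j  (A = R/I, F a form of degree j-i)
   is injective / surjective. *)
Definition mult_inj (k : fieldType) (r : nat) (I : {mpoly k[r]} -> Prop)
  (F : {mpoly k[r]}) (i : nat) : Prop :=
  forall f, homog_deg i f -> I (F * f) -> I f.
Definition mult_surj (k : fieldType) (r : nat) (I : {mpoly k[r]} -> Prop)
  (F : {mpoly k[r]}) (i j : nat) : Prop :=
  forall g, homog_deg j g -> exists2 f, homog_deg i f & I (g - F * f).

Definition SLP (k : fieldType) (r : nat) (I : {mpoly k[r]} -> Prop) : Prop :=
  forall d, (1 <= d)%N ->
    general (fun v => forall i,
      mult_inj I (linform v ^+ d) i \/ mult_surj I (linform v ^+ d) i (i + d)).

(* s = [:: n_d; n_(d-1); ...; n_j] is the d-binomial expansion of n: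
   n = C(n_d,d) + ... + C(n_j,j), n_d > ... > n_j >= j >= 1. *)
Definition binexp (n d : nat) (s : seq nat) : Prop :=
  [/\ (0 < size s <= d)%N,
      sorted (fun a b => b < a)%N s,
      (d - (size s).-1 <= last 0%N s)%N &
      n = \sum_(l < size s) 'C(nth 0%N s l, d - l)].

Definition binexp_mm (d : nat) (s : seq nat) : nat :=
  \sum_(l < size s) 'C((nth 0%N s l).-1, (d - l).-1).

Definition macaulay_mm (n d m : nat) : Prop :=
  exists s, binexp n d s /\ m = binexp_mm d s.

(* Main.v *)
Require Import Defs.
From HB Require Import structures.
From mathcomp Require Import all_boot all_order all_algebra.
From mathcomp Require Import mpoly.
From mathcomp Require Import zify.
From Stdlib Require Import Classical.
Set Implicit Arguments. Unset Strict Implicit. Unset Printing Implicit Defensive.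
Import GRing.Theory.

(** Write h_d^- for Macaulay's ((h_d)_(d))^{-1}_{-1}.

    Green's restriction theorem says that, for a general linear form L, the map
    L : A_{d-1} -> A_d has rank at least h_d^-.  In particular h_d^- <= h_{d-1}
    (Macaulay's bound), with equality only if L is injective on A_{d-1}.

    Second, for general L the map L^{N-s} : A_s -> A_N has rank at least
    min(s+1, h_N).  Indeed, where the rank of L |-> L^{N-s} is maximal, the
    derivative of this family of maps sends the kernel into the image; in
    characteristic zero this means that M L^{N-s-1} f lies in L^{N-s} A_s for every
    linear form M as soon as L^{N-s} f = 0.  Hence, once two consecutive terms of
    L^N A_0 <= L^{N-1} A_1 <= ... <= A_N agree, all later ones agree too, and the
    chain increases strictly until it reaches A_N.

    For r = 2 the second bound already is maximal rank.  For r > 2 under (ii), the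
    first gives injectivity below degree t, the second surjectivity onto degrees
    N >= t, where h_N <= 2.

    Conversely let A be defined by the lex-segment ideal.  If h_i^- < h_{i-1} for some
    i < t, then a standard monomial of degree i-1 lies in the socle, while
    L A_{i-1} <> A_i because A_i surjects onto the forms of degree i in two variables.
    If r > 2 and h_t >= 3, then L^{t-1} : A_1 -> A_t kills x_3, .., x_r (in the ordering
    where x_1, x_2 are the lex-last variables), so its rank is at most 2. *)

(** * Binomial expansions *)

(** The number of monomials of degree [d] in [a] variables; the truncated predecessor gives the
    right value 1 at [a = d = 0]. *)
Definition nmon (a d : nat) : nat := 'C((a + d).-1, d).

Lemma nmonS a d : nmon a.+1 d.+1 = nmon a d.+1 + nmon a.+1 d.
Proof. by rewrite /nmon addSn addnS /= binS. Qed.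

Lemma nmon0S d : nmon 0 d.+1 = 0.
Proof. by rewrite /nmon add0n bin_small. Qed.

Lemma nmon_d0 a : nmon a 0 = 1.
Proof. by rewrite /nmon bin0. Qed.

Lemma nmon1 d : nmon 1 d = 1.
Proof. by rewrite /nmon add1n binn. Qed.

Lemma nmon_1 a : nmon a 1 = a.
Proof. by rewrite /nmon addn1 bin1. Qed.

Lemma nmon2 d : nmon 2 d = d.+1.
Proof. by rewrite /nmon add2n /= binSn. Qed.

Lemma nmon_gt0 a d : 0 < a -> 0 < nmon a d.
Proof. by case: a => // a _; rewrite /nmon addSn /= bin_gt0 leq_addl. Qed.

Lemma leq_nmon a b d : a <= b -> nmon a d <= nmon b d.
Proof. by move=> leab; apply: leq_bin2l; lia. Qed.

Lemma ltn_nmon n d : n < nmon n.+1 d.+1.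
Proof.
by elim: n => [|n IHn]; rewrite ?nmon1 // nmonS; have := @nmon_gt0 n.+2 d isT; lia.
Qed.

(** For [d > 0], the index of the largest variable in the monomial of degree [d] and colexicographic
    rank [n], ranks and indices starting at 0. *)
Definition block (d n : nat) : nat := find (fun a => n < nmon a.+1 d) (iota 0 n.+1).

Lemma blockP d n : nmon (block d.+1 n) d.+1 <= n < nmon (block d.+1 n).+1 d.+1.
Proof.
set P := fun a => n < nmon a.+1 d.+1.
have hasP : has P (iota 0 n.+1).
  by apply/hasP; exists n; rewrite ?mem_iota /P ?ltn_nmon //; lia.
have ltf : find P (iota 0 n.+1) < n.+1 by move: hasP; rewrite has_find size_iota.
have := nth_find 0 hasP; rewrite nth_iota // add0n => Pb.
rewrite /block -/P; apply/andP; split; last exact: Pb.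
case E : (find P (iota 0 n.+1)) => [|b]; first by rewrite nmon0S.
have := @before_find _ 0 P (iota 0 n.+1) b; rewrite E ltnSn => /(_ isT).
by rewrite nth_iota ?add0n /P; lia.
Qed.

Lemma block_uniq a b d n : nmon a d <= n < nmon a.+1 d -> nmon b d <= n < nmon b.+1 d -> a = b.
Proof.
move=> /andP[a1 a2] /andP[b1 b2]; case: (ltngtP a b) => // lt.
  by have := @leq_nmon a.+1 b d lt; lia.
by have := @leq_nmon b.+1 a d lt; lia.
Qed.

(* [low d c] is Macaulay's (c_(d))^{-1}_{-1} and [high d c] is Green's c_<d>: among
   the first [c] monomials of degree [d] in colexicographic order, they count those
   which are, resp. are not, divisible by the smallest variable. *)
Fixpoint low (d c : nat) : nat :=
  if d is d'.+1 then
    if c == 0 then 0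
    else nmon (block d c) d' + low d' (c - nmon (block d c) d)
  else 0.

Definition high (d c : nat) : nat := c - low d c.

Lemma low0 d : low d 0 = 0. Proof. by case: d. Qed.

Lemma lowE_lt a d c : 0 < a -> c < nmon a.+1 d ->
  low d.+1 (nmon a d.+1 + c) = nmon a d + low d c.
Proof.
move=> a0 lec; have n0 := nmon_gt0 d.+1 a0.
have E : block d.+1 (nmon a d.+1 + c) = a.
  apply: block_uniq (blockP _ _) _; rewrite nmonS; lia.
by rewrite /= E addKn; case: eqP => //; lia.
Qed.

Arguments low : simpl never.

Lemma low_nmon a d : 0 < a -> low d.+1 (nmon a d.+1) = nmon a d.
Proof. by move=> a0; rewrite -[X in low _ X]addn0 lowE_lt ?low0 ?addn0 ?nmon_gt0. Qed.

(** The boundary value [c = nmon a.+1 d] already belongs to the next block, but Pascal's rule makes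
    both sides agree there too. *)
Lemma lowE a d c : 0 < a -> c <= nmon a.+1 d ->
  low d.+1 (nmon a d.+1 + c) = nmon a d + low d c.
Proof.
move=> a0; rewrite leq_eqVlt => /orP[/eqP ->|]; last exact: lowE_lt.
rewrite -nmonS low_nmon //; case: d => [|d]; first by rewrite !nmon_d0.
by rewrite low_nmon // nmonS.
Qed.

Lemma low1 d : low d.+1 1 = 1.
Proof. by rewrite -(nmon1 d.+1) low_nmon // !nmon1. Qed.

Lemma blockE d c : 0 < c -> exists a c',
  [/\ 0 < a, c' < nmon a.+1 d & c = nmon a d.+1 + c'].
Proof.
move=> c0; have := blockP d c; set a := block _ _ => bP.
exists a, (c - nmon a d.+1); split; last by lia.
  by case: a bP => //; rewrite nmon1 nmon0S; lia.
by move: bP; rewrite nmonS; lia.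
Qed.

(** The next monomial is either divisible by the smallest variable or not; hence both [low] and
    [high] are monotone. *)
Lemma low_step d c : low d c <= low d c.+1 <= (low d c).+1.
Proof.
elim: d c => // d IHd c; have [->|c0] := posnP c; first by rewrite low1 low0.
have [a [c' [a0 lt ->]]] := blockE d c0; rewrite -addnS !lowE //; last by lia.
by have := IHd c'; lia.
Qed.

Lemma leq_low d b c : b <= c -> low d b <= low d c.
Proof.
move=> /subnKC <-; elim: (c - b) => [|k IH]; first by rewrite addn0.
by rewrite addnS; have := low_step d (b + k); lia.
Qed.

Lemma low_leq d c : low d c <= c.
Proof. by elim: c => [|c IH]; rewrite ?low0 //; have := low_step d c; lia. Qed.

Lemma low_high d c : low d c + high d c = c.
Proof. by rewrite /high subnKC ?low_leq. Qed.

Lemma leq_high d b c : b <= c -> high d b <= high d c.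
Proof.
move=> /subnKC <-; elim: (c - b) => [|k IH]; first by rewrite addn0.
rewrite addnS; have := low_step d (b + k); rewrite /high.
by have := low_leq d (b + k); rewrite /high in IH; lia.
Qed.

Lemma highE a d c : 0 < a -> c <= nmon a.+1 d ->
  high d.+1 (nmon a d.+1 + c) = nmon a.-1 d.+1 + high d c.
Proof.
case: a => // a _ lec; rewrite /high lowE // nmonS /=.
by have := low_leq d c; lia.
Qed.

Lemma high_nmon a d : high d.+1 (nmon a.+1 d.+1) = nmon a d.+1.
Proof. by rewrite /high low_nmon // nmonS addnK. Qed.

(** The last of the [nmon a.+1 d] monomials is a power of the largest variable, so any shorter
    initial segment misses a monomial free of the smallest one. *)
Lemma high_lt a d c : 0 < a -> c < nmon a.+1 d -> high d c < nmon a d.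
Proof.
case: a => // a _; elim: d c => [|d IHd] c lt.
  by rewrite !nmon_d0 in lt *; have := low_high 0 c; lia.
have n0 := @nmon_gt0 a.+1 d isT.
case: (ltnP c (nmon a.+1 d.+1)) => [ltc|lec].
  have := leq_high d.+1 (ltnW ltc); rewrite high_nmon nmonS; lia.
rewrite nmonS in lt.
have lt' : c - nmon a.+1 d.+1 < nmon a.+2 d by lia.
rewrite -(subnKC lec) highE // ?(ltnW lt') //= [in X in _ < X]nmonS ltn_add2l.
exact: IHd.
Qed.

(** Here every term of the expansion has the form [C(j, j)], and lowering it leaves 1. *)
Lemma low_small d c : c <= d -> low d c = c.
Proof.
elim: d c => [|d IHd] [|c] // lec.
have -> : c.+1 = nmon 1 d.+1 + c by rewrite nmon1.
by rewrite lowE // ?nmon2 ?nmon1 ?IHd //; lia.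
Qed.

(** Induction on [d], removing the largest block [nmon a d.+2] of [c]: it contributes
    [nmon a.-1 d.+1] to both sides, and the remainders are compared by induction. *)
Lemma high_low_lt d c : 0 < c -> high d (low d.+1 c).-1 < low d.+1 (high d.+1 c).+1.
Proof.
elim: d c => [|d IHd] c c0.
  have [a [c' [a0]]] := blockE 0 c0; rewrite nmon_d0 ltnS leqn0 => /eqP -> ->.
  rewrite addn0 low_nmon // nmon_d0.
  by have := leq_low 1 (isT : 0 < (high 1 (nmon a 1)).+1); rewrite low1.
have [a [c' [a0 lt ->]]] := blockE d.+1 c0.
have lt' := ltnW lt; rewrite lowE // highE //.
have hl := high_lt a0 lt.
(* For [a = 1] the remainder is at most [d + 1], so [low] fixes it and the left side is 0. *)
case: a a0 lt lt' hl => // -[|a] _ lt lt' hl.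
  rewrite nmon2 in lt; have E := @low_small d.+1 c' lt.
  by rewrite E nmon1 nmon0S /high E subnn low1.
rewrite [a.+2.-1]/= -addnS lowE //.
have [->|c'0] := posnP c'.
  rewrite low0 addn0 (leq_trans (_ : _ < nmon a.+1 d.+1)) ?leq_addr // high_lt //.
  by have := @nmon_gt0 a.+2 d.+1 isT; lia.
have IH := IHd c' c'0.
have l1 : 0 < low d.+1 c' by rewrite (leq_trans _ (leq_low _ c'0)) ?low1.
have l2 : low d.+1 c' <= nmon a.+3 d.
  by rewrite -(@low_nmon a.+3 d) // leq_low.
have -> : (nmon a.+2 d.+1 + low d.+1 c').-1 = nmon a.+2 d.+1 + (low d.+1 c').-1 by lia.
have l3 : (low d.+1 c').-1 <= nmon a.+3 d by lia.
by rewrite highE // ltn_add2l.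
Qed.

(** If [x] exceeded [high d.+1 c], then [c - x] would be at most [low d.+1 c - 1], and [high_low_lt]
    would give [high d (c - x) < low d.+1 x], against the hypothesis. *)
Lemma green_numeric d c x :
  x <= c -> x <= high d.+1 x + high d (c - x) -> x <= high d.+1 c.
Proof.
move=> lexc lex; rewrite leqNgt; apply/negP => lt.
have c0 : 0 < c by lia.
have h1 := high_low_lt d c0.
have h2 := leq_low d.+1 lt.
have h3 : high d (c - x) <= high d (low d.+1 c).-1.
  by apply: leq_high; have := low_high d.+1 c; lia.
by have := low_high d.+1 x; lia.
Qed.

(** * Comparison of [low] with binomial expansions *)

Lemma binexp_cons n d a b s : binexp n d.+1 (a :: b :: s) ->
  exists n', [/\ binexp n' d (b :: s), b < a & n = 'C(a, d.+1) + n'].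
Proof.
case=> /= sz /andP[ltba srt] lst ->.
exists (\sum_(l < size (b :: s)) 'C(nth 0 (b :: s) l, d - l)); split => //.
by rewrite big_ord_recl.
Qed.

Lemma binexp_bounds n d a s : binexp n d (a :: s) ->
  [/\ d <= a, 'C(a, d) <= n & n < 'C(a.+1, d)].
Proof.
elim: s n d a => [|b s IHs] n [|d] a; try by case.
  case=> _ _ /=; rewrite big_ord1 /= !subn0 => lst ->.
  by rewrite binS; have := bin_gt0 a d; split; lia.
case/binexp_cons=> n' [/IHs[h1 h2 h3] ltba ->]; split; [lia|lia|].
rewrite binS ltn_add2l (leq_trans h3) //; exact: leq_bin2l.
Qed.

Lemma binexp_mmE n d s : binexp n d s -> binexp_mm d s = low d n.
Proof.
case: s => [|a s]; first by case.
elim: s n d a => [|b s IHs] n [|d] a be; try by case: be.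
  have [h1 _ _] := binexp_bounds be; case: be => _ _ _ ->.
  rewrite /binexp_mm !big_ord1 /= !subn0 /=.
  have -> : 'C(a, d.+1) = nmon (a - d) d.+1 by rewrite /nmon; congr 'C(_, _); lia.
  rewrite low_nmon; last by lia.
  by rewrite /nmon; congr 'C(_, _); lia.
have [h1 _ _] := binexp_bounds be.
have [n' [be' ltba ->]] := binexp_cons be.
have [h1' h2 h3] := binexp_bounds be'.
rewrite /binexp_mm [size _]/= big_ord_recl /=.
have := IHs _ _ _ be'; rewrite /binexp_mm /= => ->.
have -> : 'C(a, d.+1) = nmon (a - d) d.+1 by rewrite /nmon; congr 'C(_, _); lia.
rewrite lowE; [|by lia|].
  by rewrite /nmon; congr ('C(_, _) + _); lia.
rewrite (leq_trans (ltnW h3)) // /nmon.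
apply: leq_bin2l; lia.
Qed.

Lemma binexp_exists n d : 0 < n -> exists s, binexp n d.+1 s.
Proof.
elim: d n => [|d IHd] n n0.
  have [a [c [a0 ltc ->]]] := blockE 0 n0.
  exists [:: a]; split => //=.
  by move: ltc; rewrite nmon_d0 ltnS leqn0 => /eqP ->; rewrite big_ord1 nmon_1 /= bin1 addn0.
have [a [c [a0 ltc ->]]] := blockE d.+1 n0.
have E : nmon a d.+2 = 'C(a + d.+1, d.+2) by rewrite /nmon addnS.
have [->|c0] := posnP c.
  by exists [:: a + d.+1]; split => //=; [lia | rewrite big_ord1 addn0].
have [[|b s] bes] := IHd c c0; first by case: bes.
have [h1 h2 h3] := binexp_bounds bes.
exists [:: a + d.+1, b & s]; case: bes => sz srt lst cE; split=> //=.
  apply/andP; split=> //; rewrite ltnNge; apply/negP => le.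
  have := leq_bin2l d.+1 le; move: ltc; rewrite /nmon addSn /=; lia.
by rewrite big_ord_recl /= E cE.
Qed.

Lemma macaulay_mmP n d m : 0 < n -> 0 < d -> macaulay_mm n d m <-> m = low d n.
Proof.
case: d => // d n0 _; split=> [[s [/binexp_mmE <-]] //|->].
by have [s bes] := binexp_exists d n0; exists s; rewrite (binexp_mmE bes).
Qed.

(** * Colexicographic ranks of monomials *)

Lemma geq_trans : transitive geq.
Proof. by move=> b a c h1 h2; apply: leq_trans h2 h1. Qed.

(* The rank of a monomial among those of its degree in colexicographic order, the
   monomial being given by the nonincreasing list of the indices of its variables. *)
Fixpoint colex_rank (s : seq nat) : nat :=
  if s is a :: s' then nmon a (size s').+1 + colex_rank s' else 0.

Lemma colex_rank_lt b s : sorted geq s -> all (fun a => a < b) s ->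
  colex_rank s < nmon b (size s).
Proof.
elim: s b => [|a s IHs] b; first by rewrite nmon_d0.
move=> /= srt /andP[ltab _]; have := order_path_min geq_trans srt => le_a.
have := IHs a.+1 (path_sorted srt) le_a; have := @leq_nmon a.+1 b (size s).+1 ltab.
by rewrite nmonS; lia.
Qed.

Lemma colex_rank_block a s : sorted geq (a :: s) ->
  nmon a (size s).+1 <= colex_rank (a :: s) < nmon a.+1 (size s).+1.
Proof.
move=> srt; rewrite leq_addr; apply: (colex_rank_lt srt).
by rewrite /= ltnSn; apply: order_path_min geq_trans srt.
Qed.

Lemma colex_rank_inj s s' : sorted geq s -> sorted geq s' -> size s = size s' ->
  colex_rank s = colex_rank s' -> s = s'.
Proof.
elim: s s' => [|a s IHs] [|a' s'] // srt srt' [sz] E.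
have B := colex_rank_block srt; have B' := colex_rank_block srt'.
rewrite -E -sz in B'; have Ea := block_uniq B B'.
rewrite -Ea; congr cons; apply: (IHs _ (path_sorted srt) (path_sorted srt') sz).
by move: E; rewrite /= -Ea -sz => /addnI.
Qed.

Lemma colex_rank_surj b d m : m < nmon b d ->
  exists s, [/\ sorted geq s, size s = d, all (fun a => a < b) s & colex_rank s = m].
Proof.
elim: d b m => [|d IHd] b m; first by rewrite nmon_d0 ltnS leqn0 => /eqP ->; exists [::].
move=> lt; have := blockP d m; set a := block _ _ => /andP[h1 h2].
have [|s [srt sz als rks]] := IHd a.+1 (m - nmon a d.+1); first by rewrite nmonS in h2; lia.
have ltab : a < b by rewrite ltnNge; apply/negP => /(@leq_nmon _ _ d.+1); lia.
exists (a :: s); rewrite /= sz rks subnKC // ltab; split => //.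
  by rewrite path_min_sorted.
by apply: sub_all als => x /= ltx; lia.
Qed.

(** This justifies the reading of [low] as a count: the multiples of the smallest variable among the
    first [c] monomials come from the first [low] monomials one degree lower. *)
Lemma colex_rank_rcons s c : sorted geq s ->
  (colex_rank (rcons s 0) < c) = (colex_rank s < low (size s).+1 c).
Proof.
elim: s c => [|a s IHs] c srt.
  rewrite /= nmon0S; case: c => [|c]; first by rewrite low0.
  by rewrite (leq_trans _ (leq_low 1 (ltn0Sn c))) ?low1.
rewrite rcons_cons; have srt0 : sorted geq (a :: rcons s 0).
  by rewrite /= rcons_path /=; apply/andP; split.
have [a0|a0] := posnP a.
  have /eqP E1 : colex_rank (a :: rcons s 0) == 0.
    by have := colex_rank_block srt0; rewrite a0 nmon1; lia.
  have /eqP E2 : colex_rank (a :: s) == 0.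
    by have := colex_rank_block srt; rewrite a0 nmon1; lia.
  rewrite E1 E2; case: c => [|c]; first by rewrite low0.
  by rewrite (leq_trans _ (leq_low _ (ltn0Sn c))) ?low1.
have B := colex_rank_block srt; have := colex_rank_block srt0; rewrite size_rcons => B0.
(* Below or above the block of [a] both sides are decided by the block bounds; inside it, the block
   is subtracted and induction applies. *)
have [le|ltc] := leqP c (nmon a (size s).+2).
  have := leq_low (size s).+2 le; rewrite low_nmon // [size (a :: s)]/=; lia.
have [le'|ltc'] := leqP c (nmon a.+1 (size s).+2); last first.
  have := leq_low (size s).+2 (ltnW ltc'); rewrite low_nmon // [size (a :: s)]/=; lia.
have le2 : c - nmon a (size s).+2 <= nmon a.+1 (size s).+1.
  by rewrite nmonS in le'; rewrite leq_subLR.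
rewrite -(subnKC (ltnW ltc)) [size (a :: s)]/= lowE //.
by rewrite /= size_rcons !ltn_add2l IHs // (path_sorted srt).
Qed.

Lemma colex_rank_behead a s : sorted geq (a :: s) ->
  colex_rank (rcons s 0) <= colex_rank (a :: s).
Proof.
elim: s a => [|b s IHs] a srt; first by rewrite /= nmon0S.
have [leab srt'] := andP srt.
have := IHs b srt'; have := @leq_nmon b a (size s).+2 leab.
by rewrite /= size_rcons; lia.
Qed.

(** Trading a variable for the smallest one cannot raise the rank. Thus, among the products of a
    monomial with a variable, the one with the smallest variable comes first. *)
Lemma colex_rank_rem j s : sorted geq s -> j \in s ->
  colex_rank (rcons (rem j s) 0) <= colex_rank s.
Proof.
elim: s => // a s IHs srt; rewrite inE /= eq_sym; case: eqP => [_ _|ne /= js].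
  exact: colex_rank_behead.
rewrite size_rcons size_rem //= prednK; last by case: (s) js.
by rewrite leq_add2l IHs // (path_sorted srt).
Qed.

(** * Monomials as nonincreasing lists of variable indices *)

Section Monomials.
Variable r : nat.
Implicit Types (m : 'X_{1..r}) (i : 'I_r).

Definition mnm_seq m : seq nat :=
  sort geq (flatten [seq nseq (m i) (i : nat) | i <- enum 'I_r]).

Lemma mnm_seq_sorted m : sorted geq (mnm_seq m).
Proof. by apply: sort_sorted => a b; apply: leq_total. Qed.

Lemma mnm_seq_count m i : count_mem (i : nat) (mnm_seq m) = m i.
Proof.
rewrite count_sort count_flatten -map_comp sumnE big_map big_enum /= (bigD1 i) //=.
rewrite count_nseq /= eqxx mul1n big1 ?addn0 // => j ne.
by rewrite count_nseq /= (inj_eq val_inj) (negbTE ne).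
Qed.

Lemma mnm_seq_all m : all (fun a => a < r) (mnm_seq m).
Proof.
rewrite all_sort; apply/allP => a /flatten_mapP[i _].
by rewrite mem_nseq => /andP[_ /eqP ->].
Qed.

Lemma mnm_seq_unique m s : sorted geq s -> all (fun a => a < r) s ->
  (forall i, count_mem (i : nat) s = m i) -> mnm_seq m = s.
Proof.
move=> srt als cnt; apply: (sorted_eq geq_trans) => //.
- by move=> a b /andP[] /=; lia.
- exact: mnm_seq_sorted.
apply/allP => a _ /=; apply/eqP; have [lt|ge] := ltnP a r.
  by rewrite (mnm_seq_count m (Ordinal lt)) (cnt (Ordinal lt)).
have notin t : all (fun a => a < r) t -> count_mem a t = 0.
  by move=> al; apply/count_memPn/negP => /(allP al); rewrite ltnNge ge.
by rewrite !notin // mnm_seq_all.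
Qed.

Lemma mnm_seq_surj s : sorted geq s -> all (fun a => a < r) s -> exists m, mnm_seq m = s.
Proof.
move=> srt als; exists [multinom count_mem (i : nat) s | i < r].
by apply: mnm_seq_unique => // i; rewrite mnmE.
Qed.

Lemma mnm_seq_inj : injective mnm_seq.
Proof. by move=> m1 m2 E; apply/mnmP => i; rewrite -!mnm_seq_count E. Qed.

Lemma size_mnm_seq m : size (mnm_seq m) = mdeg m.
Proof.
rewrite size_sort size_flatten /shape -map_comp sumnE big_map big_enum mdegE /=.
by apply: eq_bigr => i _; rewrite size_nseq.
Qed.

Lemma mnm_seq_mulX m i : (i : nat) \in mnm_seq (m + U_(i)) /\
  mnm_seq m = rem (i : nat) (mnm_seq (m + U_(i))).
Proof.
have srt := mnm_seq_sorted (m + U_(i)).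
split; first by rewrite -has_pred1 has_count mnm_seq_count mnmDE mnm1E eqxx addn1.
apply: mnm_seq_unique; first exact: (subseq_sorted geq_trans (rem_subseq _ _)).
  by apply/allP => a /mem_rem; apply: (allP (mnm_seq_all _)).
move=> j; rewrite count_rem mnm_seq_count mnmDE mnm1E -has_pred1 has_count.
by rewrite mnm_seq_count mnmDE mnm1E eqxx /= (inj_eq val_inj) addn1 /= addnK.
Qed.

End Monomials.

Local Open Scope ring_scope.

(** * General points and polynomial families of vectors *)

Section Generality.
Variable k : fieldType.
Hypothesis char0 : [pchar k] =i pred0.

Lemma natr_inj_char0 (m n : nat) : m%:R = n%:R :> k -> m = n.
Proof.
suff H (a b : nat) : (a <= b)%N -> a%:R = b%:R :> k -> a = b.
  by move=> E; case: (leqP m n) => [|/ltnW] le; [exact: H | exact/esym/H].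
move=> leab E; apply/eqP; rewrite eqn_leq leab /= -subn_eq0.
apply/negPn/negP => nz; have := proj1 (pcharf0P k) char0 (b - a)%N.
by rewrite natrB // E subrr eqxx (negbTE nz).
Qed.

Lemma poly_nonroot (p : {poly k}) : p != 0 -> exists t, p.[t] != 0.
Proof.
move=> p0; apply: NNPP => H.
have /max_poly_roots : all (root p) [seq i%:R | i <- iota 0 (size p)].
  apply/allP => x _; apply/negPn/negP => nr; apply: H; exists x.
  by rewrite -/(root p x).
move/(_ p0); rewrite size_map size_iota ltnn => /implyP; rewrite implybF => /negP; apply.
by rewrite map_inj_uniq ?iota_uniq // => a b; exact: natr_inj_char0.
Qed.

Section Line.
Variables (s : nat) (v w : 'I_s -> k).

Definition line (t : k) : 'I_s -> k := fun i => v i + t * (w i - v i).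

Definition on_line (p : {mpoly k[s]}) : {poly k} :=
  mmap polyC (fun i => (v i)%:P + 'X * (w i - v i)%:P) p.

Lemma on_lineE p t : (on_line p).[t] = p.@[line t].
Proof.
rewrite /on_line /meval /mmap horner_sum; apply: eq_bigr => m _.
rewrite hornerM hornerC /mmap1 horner_prod; congr (_ * _).
by apply: eq_bigr => i _; rewrite horner_exp !hornerE.
Qed.

End Line.

(** Both polynomials are restricted to the line joining a point of one open set to a point of the
    other; the product is a nonzero univariate polynomial, which has a nonroot as the field is
    infinite. *)
Lemma general_and s (P Q : ('I_s -> k) -> Prop) :
  general P -> general Q -> general (fun v => P v /\ Q v).
Proof.
move=> [p [[v pv] pP]] [q [[w qw] qQ]]; exists (p * q); split; last first.
  by move=> u; rewrite mevalM mulf_eq0 negb_or => /andP[/pP ? /qQ].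
have nzp : on_line v w p != 0.
  apply: contraNneq pv => E; have := on_lineE v w p 0; rewrite E horner0 => ->.
  by apply/eqP/meval_eq => i; rewrite /line mul0r addr0.
have nzq : on_line v w q != 0.
  apply: contraNneq qw => E; have := on_lineE v w q 1; rewrite E horner0 => ->.
  by apply/eqP/meval_eq => i; rewrite /line mul1r subrKC.
have [t] := poly_nonroot (mulf_neq0 nzp nzq).
by rewrite hornerM !on_lineE -mevalM; exists (line v w t).
Qed.

Lemma general_T s (P : ('I_s -> k) -> Prop) : (forall v, P v) -> general P.
Proof. by move=> H; exists 1; split=> [|v _]; [exists (fun=> 0); rewrite meval1 oner_eq0|]. Qed.

Lemma general_imp s (P Q : ('I_s -> k) -> Prop) :
  (forall v, P v -> Q v) -> general P -> general Q.
Proof. by move=> H [p [pv pP]]; exists p; split=> // v /pP /H. Qed.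

Lemma general_ex s (P : ('I_s -> k) -> Prop) : general P -> exists v, P v.
Proof. by move=> [p [[v pv] pP]]; exists v; apply: pP. Qed.

Lemma general_bounded s (P : nat -> ('I_s -> k) -> Prop) m :
  (forall i, (i < m)%N -> general (P i)) ->
  general (fun v => forall i, (i < m)%N -> P i v).
Proof.
elim: m => [|m IHm] H; first exact: general_T.
have G1 := IHm (fun i lt => H i (ltnW lt)); have G2 := H m (ltnSn m).
apply: general_imp (general_and G1 G2) => v [H1 H2] i.
by rewrite ltnS leq_eqVlt => /orP[/eqP ->|/H1].
Qed.

(** A vector depending polynomially on a point. A finite list of fixed vectors with polynomial
    coefficients replaces a basis, so [V] may be infinite dimensional. *)
Definition polyfam s (V : lmodType k) (F : ('I_s -> k) -> V) : Prop :=
  exists l : seq ({mpoly k[s]} * V), forall v, F v = \sum_(x <- l) x.1.@[v] *: x.2.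

Section PolyFam.
Variable s : nat.

Lemma polyfam_ext (V : lmodType k) (F G : ('I_s -> k) -> V) :
  F =1 G -> polyfam F -> polyfam G.
Proof. by move=> E [l Fl]; exists l => v; rewrite -E. Qed.

Lemma polyfam_cst (V : lmodType k) (w : V) : polyfam (fun _ : 'I_s -> k => w).
Proof. by exists [:: (1, w)] => v; rewrite big_seq1 meval1 scale1r. Qed.

Lemma polyfamD (V : lmodType k) (F G : ('I_s -> k) -> V) :
  polyfam F -> polyfam G -> polyfam (fun v => F v + G v).
Proof. by move=> [l Fl] [m Gm]; exists (l ++ m) => v; rewrite big_cat /= Fl Gm. Qed.

Lemma polyfamZ (V : lmodType k) (p : {mpoly k[s]}) (F : ('I_s -> k) -> V) :
  polyfam F -> polyfam (fun v => p.@[v] *: F v).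
Proof.
move=> [l Fl]; exists [seq (p * x.1, x.2) | x <- l] => v.
rewrite big_map Fl scaler_sumr; apply: eq_bigr => x _.
by rewrite /= mevalM scalerA.
Qed.

Lemma polyfam_lin (V W : lmodType k) (phi : {linear V -> W}) (F : ('I_s -> k) -> V) :
  polyfam F -> polyfam (fun v => phi (F v)).
Proof.
move=> [l Fl]; exists [seq (x.1, phi x.2) | x <- l] => v.
by rewrite big_map Fl linear_sum; apply: eq_bigr => x _; rewrite linearZ.
Qed.

Lemma polyfamM (A : algType k) (F G : ('I_s -> k) -> A) :
  polyfam F -> polyfam G -> polyfam (fun v => F v * G v).
Proof.
move=> [l Fl] [m Gm]; exists [seq (x.1 * y.1, x.2 * y.2) | x <- l, y <- m] => v.
rewrite big_allpairs_dep Fl Gm mulr_suml; apply: eq_bigr => x _.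
rewrite mulr_sumr; apply: eq_bigr => y _.
by rewrite /= mevalM -scalerAr -scalerAl scalerA mulrC.
Qed.

Lemma polyfamX (A : algType k) (F : ('I_s -> k) -> A) n :
  polyfam F -> polyfam (fun v => F v ^+ n).
Proof.
move=> FF; elim: n => [|n IHn]; first exact: polyfam_cst.
by apply: polyfam_ext (polyfamM FF IHn) => v; rewrite exprS.
Qed.

Lemma polyfam_linform : polyfam (@linform k s).
Proof.
exists [seq ('X_i, 'X_i) | i <- index_enum 'I_s] => v.
by rewrite big_map; apply: eq_bigr => i _; rewrite /= mevalXU.
Qed.

(** The coordinates of the family along its value at [v0] form a matrix with polynomial entries that
    is the identity at [v0]; its determinant is the required polynomial. *)
Lemma free_general (vT : vectType k) m (F : 'I_m -> ('I_s -> k) -> vT) v0 :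
  (forall i, polyfam (F i)) -> free [tuple F i v0 | i < m] ->
  exists p : {mpoly k[s]},
    p.@[v0] != 0 /\ forall v, p.@[v] != 0 -> free [tuple F i v | i < m].
Proof.
move=> FF fr; set X := [tuple F i v0 | i < m] in fr.
have coordP (i j : 'I_m) : exists p : {mpoly k[s]},
    forall v, p.@[v] = coord X j (F i v).
  have [l Fl] := FF i; exists (\sum_(x <- l) coord X j x.2 *: x.1) => v.
  rewrite Fl !linear_sum /=; apply: eq_bigr => x _.
  by rewrite mevalZ linearZ /= mulrC.
have H : forall i, exists q : {ffun 'I_m -> {mpoly k[s]}},
    forall j v, (q j).@[v] = coord X j (F i v).
  by move=> i; have /fin_all_exists[q qP] := coordP i;
     exists [ffun j => q j] => j v; rewrite ffunE.
have [q qP] := fin_all_exists H.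
pose M : 'M[{mpoly k[s]}]_m := \matrix_(i, j) q i j.
have detE v : (\det M).@[v] = \det (\matrix_(i, j) coord X j (F i v)).
  rewrite -det_map_mx; congr (\det _); apply/matrixP => i j.
  by rewrite !mxE /= qP.
exists (\det M); split.
  rewrite detE (_ : \matrix_(i, j) _ = 1%:M) ?det1 ?oner_eq0 //.
  apply/matrixP => i j; rewrite !mxE.
  have -> : F i v0 = X`_i by rewrite (nth_map i) ?size_enum_ord // nth_ord_enum.
  by rewrite coord_free // eq_sym.
move=> v; rewrite detE => nz; apply/freeP => c c0 i.
set A := \matrix_(i, j) _ in nz.
have Au : A \in unitmx by rewrite unitmxE unitfE.
have : \row_i c i *m A = 0.
  apply/rowP => j; rewrite !mxE -[RHS](linear0 (coord X j)) -c0 linear_sum.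
  apply: eq_bigr => l _; rewrite !mxE linearZ /=; congr (_ * coord _ _ _).
  by rewrite (nth_map l) ?size_enum_ord // nth_ord_enum.
by move/(congr1 (mulmx^~ (invmx A))); rewrite mulmxK // mul0mx => /rowP/(_ i); rewrite !mxE.
Qed.

(** Lower semicontinuity of the rank: preimages of [m] basis vectors of the image at [v0] keep
    independent images on an open set. *)
Lemma rank_general (aT vT : vectType k) (phi : ('I_s -> k) -> 'Hom(aT, vT)) v0 m :
  (forall u, polyfam (fun v => phi v u)) -> (m <= \dim (limg (phi v0)))%N ->
  general (fun v => (m <= \dim (limg (phi v)))%N).
Proof.
move=> Fphi le; set b := vbasis (limg (phi v0)).
pose u (i : 'I_m) := ((phi v0)^-1)%VF b`_i.
have [] := @free_general vT m (fun i v => phi v (u i)) v0 _ _; first by move=> i; apply: Fphi.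
  have -> : [tuple phi v0 (u i) | i < m] = take m b :> seq _.
    apply: (@eq_from_nth _ 0); first by rewrite size_tuple size_takel // size_tuple.
    move=> i; rewrite size_tuple => lt; rewrite nth_take //.
    rewrite (nth_map (Ordinal lt)) ?size_enum_ord //.
    have -> : nth (Ordinal lt) (enum 'I_m) i = Ordinal lt.
      by apply: val_inj; rewrite /= nth_enum_ord.
    rewrite limg_lfunVK // /b; apply/vbasis_mem/mem_nth.
    by rewrite size_tuple (leq_trans lt).
  have := basis_free (vbasisP (limg (phi v0))).
  by rewrite -{1}(cat_take_drop m b) => /catl_free.
move=> p [p0 pP]; exists p; split=> [|v /pP fr]; first by exists v0.
move: fr; rewrite /free size_tuple => /eqP <-; apply/dimvS/span_subvP => x.
by case/mapP => i _ ->; apply: memv_img; rewrite memvf.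
Qed.

End PolyFam.

(** Plays the quotient map by [V]: an endomorphism whose kernel is [V]. *)
Definition modv (vT : vectType k) (V : {vspace vT}) : 'End(vT) := (\1 - projv V)%VF.

Lemma lker_modv (vT : vectType k) (V : {vspace vT}) : lker (modv V) = V.
Proof.
apply/vspaceP => x; rewrite memv_ker add_lfunE opp_lfunE id_lfunE subr_eq0.
by apply/eqP/idP => [->|/projv_id ->] //; rewrite memv_proj.
Qed.

Lemma dim_addv_modv (vT : vectType k) (V U : {vspace vT}) :
  \dim (V + U) = (\dim V + \dim (modv V @: U))%N.
Proof.
rewrite -(limg_ker_dim (modv V) (V + U)) lker_modv; congr (_ + _)%N.
  by congr (\dim _); rewrite capvC; apply/capv_idPl; rewrite addvSl.
rewrite limgD (_ : modv V @: V = 0)%VS ?add0v //.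
by apply/eqP; rewrite -lkerE lker_modv.
Qed.

Lemma dim_preim (aT vT : vectType k) (f : 'Hom(aT, vT)) (V : {vspace vT}) :
  (\dim (f @^-1: V) + \dim (V + limg f) = dim aT + \dim V)%N.
Proof.
rewrite dim_addv_modv addnCA addnC; congr (_ + _)%N.
rewrite -dimvf -(limg_ker_dim (modv V \o f) fullv) limg_comp capfv; congr (_ + _)%N.
by congr (\dim _); apply/vspaceP => x; rewrite -memv_preim memv_ker comp_lfunE -memv_ker lker_modv.
Qed.

Lemma addv_rank_general s (aT vT : vectType k) (V : {vspace vT})
    (phi : ('I_s -> k) -> 'Hom(aT, vT)) v0 m :
  (forall u, polyfam (fun v => phi v u)) -> (m <= \dim (V + limg (phi v0)))%N ->
  general (fun v => (m <= \dim (V + limg (phi v)))%N).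
Proof.
move=> Fphi; rewrite dim_addv_modv -leq_subLR -limg_comp => le.
have := @rank_general s aT vT (fun v => modv V \o phi v)%VF v0 _ _ le.
case=> [u|p [pv pP]].
  by apply: polyfam_ext (polyfam_lin (modv V) (Fphi u)) => v; rewrite comp_lfunE.
by exists p; split=> // v /pP; rewrite dim_addv_modv -leq_subLR limg_comp.
Qed.

End Generality.

(** * Multiplication maps between spaces of forms *)

Section Forms.
Variables (k : fieldType) (n : nat).
Local Notation form := (dhomog n.+1 k).
Local Notation R := {mpoly k[n.+1]}.

Definition to_form d (p : R) : form d := DHomog (pihomogP mdeg d p).

Lemma to_form_linear d : linear (to_form d).
Proof. by move=> a p q; apply: val_inj; rewrite /= linearP. Qed.

HB.instance Definition _ d :=
  GRing.isLinear.Build k R (form d) _ (to_form d) (to_form_linear d).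

Lemma val_to_form d (p : R) : p \is d.-homog for mdeg -> to_form d p = p :> R.
Proof. exact: pihomog_dE. Qed.

Lemma to_form_val d (f : form d) : to_form d f = f.
Proof. by apply: val_inj; exact: (val_to_form (dhomog_is_dhomog f)). Qed.

(** The target degree is a separate argument, which avoids transport along equalities of degrees;
    this is multiplication by [F] when [F] is homogeneous of degree [e - d]. *)
Definition hmul_fun (F : R) d e (f : form d) : form e := to_form e (F * f).

Lemma hmul_fun_linear F d e : linear (@hmul_fun F d e).
Proof. by move=> a f g; rewrite /hmul_fun !linearP /= mulrDr -scalerAr linearP. Qed.

HB.instance Definition _ F d e :=
  GRing.isLinear.Build k (form d) (form e) _ (@hmul_fun F d e) (@hmul_fun_linear F d e).

Definition hmul (F : R) d e : 'Hom(form d, form e) := linfun (@hmul_fun F d e).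

Lemma hmulE F d e f : hmul F d e f = to_form e (F * f).
Proof. by rewrite lfunE. Qed.

Lemma val_hmul F c d e (f : form d) : F \is c.-homog for mdeg -> e = (c + d)%N ->
  hmul F d e f = F * f :> R.
Proof.
by move=> Fc ->; rewrite hmulE val_to_form // dhomogM // dhomog_is_dhomog.
Qed.

Lemma hmul_comp F G c d e e' (f : form d) : G \is c.-homog for mdeg -> e = (c + d)%N ->
  hmul F e e' (hmul G d e f) = hmul (F * G) d e' f.
Proof. by move=> Gc E; rewrite hmulE (val_hmul _ Gc E) hmulE mulrA. Qed.

Lemma hmul_homogX (F : R) d : F \is 1.-homog for mdeg -> F ^+ d \is d.-homog for mdeg.
Proof. by move=> /(dhomogMn d); rewrite mul1n. Qed.

Lemma linform_homog (v : 'I_n.+1 -> k) : linform v \is 1.-homog for mdeg.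
Proof. by apply: rpred_sum => i _; apply: rpredZ; rewrite dhomogX /= mdeg1. Qed.

Lemma X_homog i : ('X_i : R) \is 1.-homog for mdeg.
Proof. by rewrite dhomogX /= mdeg1. Qed.

Lemma linform_X i : linform (fun j => (i == j)%:R) = 'X_i :> R.
Proof.
rewrite /linform (bigD1 i) //= eqxx scale1r big1 ?addr0 // => j.
by rewrite eq_sym => /negbTE ->; rewrite scale0r.
Qed.

Lemma linform_line (v w : 'I_n.+1 -> k) t :
  linform (fun i => v i + t * w i) = linform v + t *: linform w.
Proof.
by rewrite /linform scaler_sumr -big_split; apply: eq_bigr => i _; rewrite scalerDl scalerA.
Qed.

Lemma polyfam_hmul s (F : ('I_s -> k) -> R) d e (f : form d) :
  polyfam F -> polyfam (fun v => hmul (F v) d e f).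
Proof.
move=> FF; have FM := polyfamM FF (polyfam_cst s (f : R)).
by apply: polyfam_ext (polyfam_lin (to_form e) FM) => v; rewrite hmulE.
Qed.

Lemma sum_limg_X s : (\sum_(i < n.+1) limg (hmul 'X_i s s.+1) = fullv)%VS.
Proof.
apply/eqP; rewrite eqEsubv subvf /=; apply/subvP => g _.
rewrite -(to_form_val g) (mpolyE g) linear_sum big_seq; apply: memv_suml => m mg.
rewrite linearZ /=; apply: memvZ.
have dm : mdeg m = s.+1 by apply: (dhomog_mf (dhomog_is_dhomog g)).
have [i mi] : exists i, m i != 0%N.
  apply: NNPP => H; move: dm; rewrite mdegE big1 // => i _.
  by apply/eqP/negPn/negP => mi; apply: H; exists i.
apply: (subvP (sumv_sup i _ (subvv _))) => //.
apply/memv_imgP; exists (to_form s 'X_[m - U_(i)]); rewrite ?memvf // hmulE val_to_form.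
  by rewrite -mpolyXD addmC submK // lep1mP.
rewrite dhomogX; apply/eqP/succn_inj; rewrite -dm /= -addn1 -(mdeg1 i) -mdegD.
by rewrite submK ?lep1mP.
Qed.

Lemma limg_X_subP s (vT : vectType k) (phi : 'Hom(form s.+1, vT)) (W : {vspace vT}) :
  (forall i f, phi (hmul 'X_i s s.+1 f) \in W) -> (limg phi <= W)%VS.
Proof.
move=> H; rewrite -(sum_limg_X s) limg_sum; apply/subv_sumP => i _.
rewrite -limg_comp; apply/subvP => x /memv_imgP[f _ ->].
by rewrite comp_lfunE H.
Qed.

End Forms.

(** * First-order variation of powers of a linear form *)

Section Tangent.
Variables (k : fieldType) (n : nat).
Hypothesis char0 : [pchar k] =i pred0.
Local Notation form := (dhomog n.+1 k).
Local Notation R := {mpoly k[n.+1]}.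

(* ((L + t M)^c - L^c) / t *)
Fixpoint diffquo (L M : R) (c : nat) (t : k) : R :=
  if c is c'.+1 then M * L ^+ c' + (L + t *: M) * diffquo L M c' t else 0.

Lemma diffquoE L M c t : (L + t *: M) ^+ c = L ^+ c + t *: diffquo L M c t.
Proof.
elim: c => [|c IHc] /=; first by rewrite scaler0 addr0.
by rewrite exprS IHc mulrDr mulrDl -scalerAl -scalerAr scalerDr -addrA -exprS.
Qed.

Lemma diffquo0 L M c : diffquo L M c.+1 0 = c.+1%:R *: (M * L ^+ c).
Proof.
elim: c => [|c IHc]; first by rewrite /= scale1r mulr0 addr0.
rewrite [LHS]/= -/(diffquo L M c.+1 0) IHc scale0r addr0 -scalerAr mulrCA -exprS.
by rewrite -{1}[M * _]scale1r -scalerDl -(natrD _ 1) add1n.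
Qed.

Lemma polyfam_line_linform (v w : 'I_n.+1 -> k) :
  polyfam (fun x : 'I_1 -> k => linform v + x ord0 *: linform w).
Proof.
apply: polyfamD (polyfam_cst _ _) _.
by apply: polyfam_ext (polyfamZ 'X_ord0 (polyfam_cst _ (linform w))) => x; rewrite mevalXU.
Qed.

Lemma polyfam_diffquo (v w : 'I_n.+1 -> k) c :
  polyfam (fun x : 'I_1 -> k => diffquo (linform v) (linform w) c (x ord0)).
Proof.
elim: c => [|c IHc] /=; first exact: polyfam_cst.
exact: polyfamD (polyfam_cst _ _) (polyfamM (polyfam_line_linform v w) IHc).
Qed.

Lemma free_leq_dim (vT : vectType k) (X : seq vT) (U : {vspace vT}) :
  free X -> {subset X <= U} -> (size X <= \dim U)%N.
Proof. by rewrite /free => /eqP <- /span_subvP; apply: dimvS. Qed.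

(* Along the line v + t w, a kernel element f whose image under the derivative leaves the
   image of L_v^(c+1) would give one more independent vector for general t <> 0. *)
Lemma tangent_max_rank s c N (V : {vspace form N}) v (f : form s) w :
  (forall u, (\dim (V + limg (hmul (linform u ^+ c.+1) s N))
              <= \dim (V + limg (hmul (linform v ^+ c.+1) s N)))%N) ->
  hmul (linform v ^+ c.+1) s N f \in V ->
  hmul (linform w * linform v ^+ c) s N f \in (V + limg (hmul (linform v ^+ c.+1) s N))%VS.
Proof.
move=> vmax fV; apply/negPn/negP => nin.
pose phi (x : 'I_1 -> k) := hmul ((linform v + x ord0 *: linform w) ^+ c.+1) s N.
pose x0 : 'I_1 -> k := fun=> 0.
have phi0 : phi x0 = hmul (linform v ^+ c.+1) s N by rewrite /phi scale0r addr0.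
pose G (x : 'I_1 -> k) := modv V (hmul (diffquo (linform v) (linform w) c.+1 (x ord0)) s N f).
pose b := vbasis (limg (modv V \o phi x0)%VF).
pose rho := \dim (limg (modv V \o phi x0)%VF).
pose u (i : 'I_rho) := ((modv V \o phi x0)^-1)%VF b`_i.
pose F (i : 'I_rho.+1) (x : 'I_1 -> k) :=
  if unlift ord0 i is Some j then modv V (phi x (u j)) else G x.
have FE x : [tuple F i x | i < rho.+1] = G x :: [tuple modv V (phi x (u j)) | j < rho] :> seq _.
  rewrite /= !enum_ordSl /= {1}/F unlift_none; congr cons.
  by rewrite -map_comp; apply: eq_map => j; rewrite /F /= liftK.
have FF i : polyfam (F i).
  rewrite /F; case: (unlift ord0 i) => [j|]; apply: polyfam_lin; apply: polyfam_hmul.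
    exact: polyfamX (polyfam_line_linform v w).
  exact: (polyfam_diffquo v w c.+1).
(* At the base point [G] is [c + 1] times the class of [L_w L_v^c f]; as [c + 1] is invertible, a
   dependence would contradict [nin]. *)
have fr : free [tuple F i x0 | i < rho.+1].
  have bE : [tuple modv V (phi x0 (u j)) | j < rho] = b :> seq _.
    apply: (@eq_from_nth _ 0); rewrite ?size_tuple // => i lt.
    rewrite (nth_map (Ordinal lt)) ?size_enum_ord //.
    have -> : nth (Ordinal lt) (enum 'I_rho) i = Ordinal lt.
      by apply: val_inj; rewrite /= nth_enum_ord.
    rewrite -comp_lfunE limg_lfunVK // /b; apply/vbasis_mem/mem_nth.
    by rewrite size_tuple.
  rewrite FE bE free_cons (basis_free (vbasisP _)) andbT (span_basis (vbasisP _)).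
  apply: contra nin; rewrite /G diffquo0 limg_comp => /memv_imgP[y /memv_imgP[z _ ->]].
  rewrite phi0 => /eqP; rewrite -subr_eq0 -linearB -memv_ker lker_modv.
  set y1 := hmul (_ *: _) _ _ f; set y2 := hmul _ _ _ z => dV.
  have -> : hmul (linform w * linform v ^+ c) s N f = (c.+1%:R)^-1 *: y1.
    rewrite /y1 !hmulE -scalerAl linearZ /= scalerA mulVf ?scale1r //.
    by rewrite (proj1 (pcharf0P k) char0).
  apply: memvZ; rewrite -(subrK y2 y1) memv_add //; exact: memv_img (memvf _).
have [p [p0 pP]] := free_general FF fr.
have G1 : general (fun x : 'I_1 -> k => free [tuple F i x | i < rho.+1]).
  by exists p; split=> //; exists x0.
have G2 : general (fun x : 'I_1 -> k => x ord0 != 0).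
  exists 'X_ord0; split=> [|x]; last by rewrite mevalXU.
  by exists (fun=> 1); rewrite mevalXU oner_eq0.
have [x [frx nzx]] := general_ex (general_and char0 G1 G2).
have := vmax (fun i => v i + x ord0 * w i).
rewrite linform_line -/(phi x) -phi0 !dim_addv_modv leq_add2l leqNgt => /negP; apply.
have -> : \dim (modv V @: limg (phi x0)) = rho by rewrite /rho limg_comp.
have := free_leq_dim frx (U := (modv V @: limg (phi x))%VS).
rewrite size_tuple; apply=> y; rewrite FE inE => /orP[/eqP ->|/mapP[j _ ->]]; last first.
  by do 2! apply: memv_img; apply: memvf.
(* Since [L_v^(c+1) f] lies in [V], the difference quotient is, modulo [V], the image of [f] divided
   by the parameter, so it stays in the image. *)
have -> : G x = modv V (phi x ((x ord0)^-1 *: f)).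
  have : phi x f = hmul (linform v ^+ c.+1) s N f
      + x ord0 *: hmul (diffquo (linform v) (linform w) c.+1 (x ord0)) s N f.
    by rewrite /phi !hmulE diffquoE mulrDl linearD -scalerAl linearZ.
  move=> E; rewrite linearZ /= E scalerDr scalerA mulVf // scale1r linearD linearZ /= /G.
  have /eqP -> : modv V (hmul (linform v ^+ c.+1) s N f) == 0 by rewrite -memv_ker lker_modv.
  by rewrite scaler0 add0r.
by do 2! apply: memv_img; apply: memvf.
Qed.

End Tangent.

Lemma exists_max_nat (T : Type) (x0 : T) (F : T -> nat) (M : nat) :
  (forall x, (F x <= M)%N) -> exists x, forall y, (F y <= F x)%N.
Proof.
move=> bF; apply: NNPP => H.
have grow m : exists x, (m <= F x)%N.
  elim: m => [|m [x lx]]; first by exists x0.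
  apply: NNPP => H'; apply: H; exists x => y; rewrite leqNgt; apply/negP => lt.
  by apply: H'; exists y; apply: leq_ltn_trans lt.
by have [x] := grow M.+1; rewrite ltnNge bF.
Qed.

(** * The chain of images of powers of a general linear form *)

Section Chain.
Variables (k : fieldType) (n : nat).
Hypothesis char0 : [pchar k] =i pred0.
Local Notation form := (dhomog n.+1 k).

Lemma polyfam_hmul_linformX c d e (f : form d) :
  polyfam (fun v => hmul (linform v ^+ c) d e f).
Proof. exact/polyfam_hmul/polyfamX/polyfam_linform. Qed.

Variables (N : nat) (V : {vspace form N}).

Definition powimg v s := (V + limg (hmul (linform v ^+ (N - s)) s N))%VS.

(** For each [s] the maximal dimension is attained somewhere, hence at a general point; only
    finitely many [s] occur. *)
Lemma general_powimg_max :
  general (fun v => forall s, (s < N.+1)%N -> forall u, (\dim (powimg u s) <= \dim (powimg v s))%N).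
Proof.
apply: general_bounded => // s _.
have [v0 v0max] := @exists_max_nat _ (fun=> 0 : k) (fun v => \dim (powimg v s)) _
  (fun v => dimvS (subvf (powimg v s))).
have := addv_rank_general (polyfam_hmul_linformX (N - s) N) (leqnn (\dim (powimg v0 s))).
by apply: general_imp => v le u; apply: leq_trans (v0max u) le.
Qed.

Section MaxRank.
Variable v : 'I_n.+1 -> k.
Hypothesis vmax : forall s, (s < N.+1)%N ->
  forall u, (\dim (powimg u s) <= \dim (powimg v s))%N.

(** Starting the chain with [V] itself lets the first step, [L^N] in [V], count as a possible
    stall. *)
Let powchain s := if s is s'.+1 then powimg v s' else V.

Lemma powchain_sub s : (s <= N)%N -> (powchain s <= powimg v s)%VS.
Proof.
case: s => [|s] leN; first exact: addvSl.
rewrite subv_add addvSl; apply/subvP => x /memv_imgP[f _ ->].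
apply: (subvP (addvSr _ _)).
have -> : hmul (linform v ^+ (N - s)) s N f
    = hmul (linform v ^+ (N - s.+1)) s.+1 N (hmul (linform v) s s.+1 f).
  by rewrite (hmul_comp _ _ _ (linform_homog v)) // -exprSr subnSK.
exact: memv_img (memvf _).
Qed.

(** After a stall, every form of degree [s] agrees modulo a multiple of [L] with a form killed by
    [L^(N-s)] modulo [V], to which [tangent_max_rank] applies. Products with variables then span the
    next degree. *)
Lemma powchain_stall s : (s < N)%N -> powimg v s = powchain s ->
  (powimg v s.+1 <= powimg v s)%VS.
Proof.
move=> ltN E; rewrite subv_add addvSl /=; apply: limg_X_subP => i f.
have ENs : (N - s)%N = (N - s.+1).+1 by rewrite subnSK.
have tan w (g : form s) : hmul (linform v ^+ (N - s)) s N g \in V ->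
    hmul (linform w * linform v ^+ (N - s.+1)) s N g \in powimg v s.
  rewrite /powimg ENs; apply: (tangent_max_rank char0) => u.
  by rewrite -ENs; apply: vmax; apply: ltnW.
rewrite (hmul_comp _ _ _ (X_homog k i)) // mulrC -linform_X.
have : hmul (linform v ^+ (N - s)) s N f \in powchain s.
  by rewrite -E; apply: (subvP (addvSr _ _)); apply: memv_img (memvf _).
case: (s) f E ENs tan ltN => [|s'] f E ENs tan ltN /=; first exact: tan.
case/memv_addP => x xV [y /memv_imgP[g _ ->] fE].
(* In [f = (f - L g) + L g] the first summand is covered by [tan]; the second contributes [L^(N-s)]
   times the product of [g] with the variable. *)
rewrite -(subrK (hmul (linform v) s' s'.+1 g) f) linearD /=; apply: memvD.
  apply: tan; rewrite linearB /= fE (hmul_comp _ _ _ (linform_homog v)) // -exprSr.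
  by rewrite subnSK ?addrK // ltnW.
rewrite (hmul_comp _ _ _ (linform_homog v)) // -mulrA -exprSr -ENs mulrC.
rewrite -(@hmul_comp _ _ _ _ 1 s' s'.+1) ?linform_homog //.
by apply: (subvP (addvSr _ _)); apply: memv_img (memvf _).
Qed.

Lemma powimg_full : powimg v N = fullv.
Proof.
apply/eqP; rewrite eqEsubv subvf /=; apply/subvP => f _.
apply: (subvP (addvSr _ _)); apply/memv_imgP; exists f; rewrite ?memvf // subnn expr0.
by rewrite hmulE mul1r to_form_val.
Qed.

Lemma powchain_dim s : (s <= N.+1)%N ->
  powchain s = fullv \/ (\dim V + s <= \dim (powchain s))%N.
Proof.
elim: s => [|s IHs] leN; first by right; rewrite addn0.
have [E|ne] := eqVneq (powimg v s) (powchain s).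
  (* One stall propagates up to degree [N], where the image is the whole space. *)
  left; suff H j : (s + j <= N)%N ->
      (powimg v (s + j) <= powimg v s)%VS /\ powimg v (s + j) = powchain (s + j).
    have [] := H (N - s)%N; rewrite subnKC // powimg_full => sub _.
    by apply/eqP; rewrite eqEsubv subvf.
  elim: j => [|j IHj]; rewrite ?addn0 // addnS => le.
  have [sub Ej] := IHj (ltnW le); have st := powchain_stall le Ej.
  split; first exact: subv_trans sub.
  by apply/eqP; rewrite eqEsubv st (powchain_sub le).
have sub := powchain_sub leN.
have lt : (\dim (powchain s) < \dim (powimg v s))%N.
  rewrite ltn_neqAle dimvS // andbT; apply: contra ne => /eqP Ed.
  by rewrite eq_sym eqEdim sub Ed leqnn.
case: (IHs (ltnW leN)) => [Ef|le]; last by right; rewrite [powchain _]/=; lia.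
by left; apply/eqP; rewrite eqEsubv subvf -Ef.
Qed.

Lemma powimg_dim s : (s <= N)%N ->
  powimg v s = fullv \/ (\dim V + s.+1 <= \dim (powimg v s))%N.
Proof. exact: (@powchain_dim s.+1). Qed.

End MaxRank.

Lemma general_powimg : general (fun v => forall s, (s <= N)%N ->
  powimg v s = fullv \/ (\dim V + s.+1 <= \dim (powimg v s))%N).
Proof.
by apply: general_imp general_powimg_max => v vmax s; apply: powimg_dim.
Qed.

End Chain.

(** * Green's hyperplane restriction theorem *)

Section Green.
Variables (k : fieldType) (n : nat).
Hypothesis char0 : [pchar k] =i pred0.
Local Notation form := (dhomog n.+1 k).

Definition codim (vT : vectType k) (U : {vspace vT}) := (dim vT - \dim U)%N.

Lemma dim_codim (vT : vectType k) (U : {vspace vT}) : (\dim U + codim U)%N = dim vT.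
Proof. by rewrite subnKC // -dimvf dimvS ?subvf. Qed.

Lemma codimS (vT : vectType k) (U W : {vspace vT}) : (U <= W)%VS -> (codim W <= codim U)%N.
Proof. by move=> /dimvS le; have := dim_codim U; have := dim_codim W; lia. Qed.

(** Dimension count in the exact sequence [0 -> aT/f^-1(V) -> vT/V -> vT/(V + im f) -> 0]. *)
Lemma codim_preim (aT vT : vectType k) (f : 'Hom(aT, vT)) (V : {vspace vT}) :
  (codim (f @^-1: V) + codim (V + limg f) = codim V)%N.
Proof.
have := dim_preim f V; have := dim_codim (f @^-1: V)%VS.
have := dim_codim (V + limg f)%VS; have := dim_codim V.
by have := dimvS (addvSl V (limg f)); lia.
Qed.

Lemma preim_eq_of_dim (aT vT : vectType k) (f : 'Hom(aT, vT)) (U : {vspace aT})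
    (V : {vspace vT}) :
  (U <= f @^-1: V)%VS -> (\dim V + codim U <= \dim (V + limg f))%N -> U = (f @^-1: V)%VS.
Proof.
move=> sub le; apply/eqP; rewrite eqEdim sub /=; have := codim_preim f V.
have := dim_codim U; have := dim_codim (f @^-1: V)%VS.
by have := dim_codim V; have := dim_codim (V + limg f)%VS; lia.
Qed.

Lemma codim_hmul_general d (V : {vspace form d.+1}) v0 :
  general (fun v => (codim (V + limg (hmul (linform v) d d.+1))
                     <= codim (V + limg (hmul (linform v0) d d.+1)))%N).
Proof.
have H (u : form d) : polyfam (fun v => hmul (linform v) d d.+1 u).
  exact: polyfam_hmul (polyfam_linform _ _).
have := addv_rank_general H (leqnn (\dim (V + limg (hmul (linform v0) d d.+1)))).
by apply: general_imp => v le; rewrite /codim leq_sub2l.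
Qed.

Lemma exists_codim_min (T : Type) (x0 : T) (vT : vectType k) (F : T -> {vspace vT}) :
  exists x, forall y, (codim (F x) <= codim (F y))%N.
Proof.
have [x xmax] := exists_max_nat x0 (fun x => dimvS (subvf (F x))).
by exists x => y; rewrite leq_sub2l.
Qed.

(* With c = codim V and x the codimension of V + L R_d for general L, restricting
   to a second general hyperplane gives x <= x_<d+1> + (c - x)_<d>, whence
   x <= c_<d+1> by [green_numeric]. *)
Theorem green_hyperplane_restriction d (V : {vspace form d.+1}) :
  exists v, (codim (V + limg (hmul (linform v) d d.+1)) <= high d.+1 (codim V))%N.
Proof.
(* Some variable must lower a positive codimension, because the multiples of all the variables
   span. *)
have drop e (U : {vspace form e.+1}) : (0 < codim U)%N ->
    exists v, (codim (U + limg (hmul (linform v) e e.+1)) < codim U)%N.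
  move=> cU; apply: NNPP => H; suff sub : (fullv <= U)%VS.
    by have := dimvS sub; rewrite dimvf; rewrite /codim in cU; lia.
  rewrite -(sum_limg_X k n e); apply/subv_sumP => i _; rewrite -linform_X.
  set w := (fun j => _); apply/negPn/negP => nsub; apply: H; exists w.
  have lt : (\dim U < \dim (U + limg (hmul (linform w) e e.+1)))%N.
    rewrite ltn_neqAle dimvS ?addvSl // andbT; apply: contra nsub => /eqP E.
    apply/addv_idPl/eqP; rewrite eq_sym eqEdim addvSl E leqnn //.
  by have := dim_codim U; have := dim_codim (U + limg (hmul (linform w) e e.+1))%VS; lia.
elim: d V => [|d IHd] V.
  have [c0|c0] := posnP (codim V).
    by exists (fun=> 0); rewrite (leq_trans (codimS (addvSl _ _))) // c0.
  have [v lt] := drop _ _ c0; exists v.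
  have [a [c' [a0]]] := blockE 0 c0; rewrite nmon_d0 ltnS leqn0 => /eqP -> E.
  by move: lt; rewrite E addn0 /high low_nmon // nmon_d0 nmon_1; lia.
move: {2}(codim V) (leqnn (codim V)) => m; elim: m V => [|m IHm] V lem.
  by exists (fun=> 0); rewrite (leq_trans (codimS (addvSl _ _))) //; lia.
have [c0|c0] := posnP (codim V).
  by exists (fun=> 0); rewrite (leq_trans (codimS (addvSl _ _))) // c0.
pose mu (v : 'I_n.+1 -> k) := hmul (linform v) d.+1 d.+2.
have [v0 v0min] := exists_codim_min (fun=> 0 : k) (fun v => (V + limg (mu v))%VS).
exists v0; set x := codim (V + limg (hmul (linform v0) _ _)).
have ltx : (x < codim V)%N by have [v /(leq_ltn_trans (v0min v))] := drop _ _ c0.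
(* An optimal pair of linear forms; the general [h] and [h'] below replace its members one at a time
   without increasing the codimension. *)
have [[w1 w1'] wmin] := exists_codim_min ((fun=> 0 : k), (fun=> 0 : k))
  (fun w => (V + limg (mu w.1) + limg (mu w.2))%VS).
have wx : (codim (V + limg (mu w1) + limg (mu w1')) <= high d.+2 x)%N.
  have [|u leu] := IHm (V + limg (mu v0))%VS; first by rewrite -/x; lia.
  exact: leq_trans (wmin (v0, u)) leu.
have [h [hmin hw]] := general_ex (general_and char0 (codim_hmul_general V v0)
  (codim_hmul_general (V + limg (mu w1'))%VS w1)).
(* The colon space of [V] by the form of [h] has codimension [codim V - x] in one degree less, where
   the outer induction applies. *)
pose W := (mu h @^-1: V)%VS.
have [u0 leu0] := IHd W.
have [h' [[h'min h'w] h'W]] := general_ex (general_and char0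
  (general_and char0 (codim_hmul_general V v0) (codim_hmul_general (V + limg (mu h))%VS w1'))
  (codim_hmul_general W u0)).
have Eh' : codim (V + limg (mu h')) = x.
  by apply/eqP; rewrite eqn_leq h'min v0min.
have Eh : codim (V + limg (mu h)) = x.
  by apply/eqP; rewrite eqn_leq hmin v0min.
have cW : codim W = (codim V - x)%N by rewrite -(codim_preim (mu h) V) Eh addnK.
(* The value [x], realised by [h'], splits along multiplication by [L_h]: the cokernel is bounded by
   [wx], and the other part by the restriction of [W] to [L_h'], as [W + L_h' R_d] lies in the
   preimage. *)
apply: green_numeric (ltnW ltx) _.
rewrite -{1}Eh' -(codim_preim (mu h)) addnC leq_add //.
  have addvAC A B : (V + A + B = V + B + A)%VS by rewrite -addvA (addvC A) addvA.
  rewrite addvAC (leq_trans h'w) // addvAC (leq_trans hw) // addvAC; exact: wx.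
rewrite -cW (leq_trans _ (leq_trans h'W leu0)) //; apply: codimS.
rewrite subv_add lpreimS ?addvSl //=; apply/subvP => y /memv_imgP[g _ ->].
rewrite -memv_preim /mu (hmul_comp _ _ _ (linform_homog h')) // mulrC.
rewrite -(hmul_comp _ (e := d.+1) _ _ (linform_homog h)) //.
by apply: (subvP (addvSr _ _)); apply: memv_img (memvf _).
Qed.

End Green.

(** * Lex-segment ideals *)

Section LexIdeal.
Variables (k : fieldType) (r' : nat).
Local Notation r := r'.+2.
Variable h : nat -> nat.
Hypothesis h_low : forall d, (low d.+1 (h d.+1) <= h d)%N.
Hypothesis h_nmon : forall d, (h d <= nmon r d)%N.
Implicit Types (m : 'X_{1..r}) (p q : {mpoly k[r]}).

(** The first [h d] monomials of degree [d] are standard; the remaining ones, the lex-largest, will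
    span the ideal. *)
Definition stdm m : bool := (colex_rank (mnm_seq m) < h (mdeg m))%N.

(** If a product of [m] with some variable is standard, so is the product with the smallest
    variable. *)
Lemma stdm_mulX_low m i : stdm (m + U_(i)) ->
  (colex_rank (mnm_seq m) < low (mdeg m).+1 (h (mdeg m).+1))%N.
Proof.
have [im E] := mnm_seq_mulX m i.
rewrite /stdm mdegD mdeg1 addn1 => std.
have := colex_rank_rcons (h (mdeg m).+1) (mnm_seq_sorted m).
rewrite size_mnm_seq => <-; rewrite E.
exact: leq_ltn_trans (colex_rank_rem (mnm_seq_sorted _) im) std.
Qed.

(** Variables are removed one at a time, and [h_low], Macaulay's bound, keeps the quotient
    standard. *)
Lemma stdm_dvd m1 m2 : stdm (m1 + m2) -> stdm m2.
Proof.
move E: (mdeg m1) => d; elim: d m1 E => [|d IHd] m1.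
  by move/eqP; rewrite mdeg_eq0 => /eqP ->; rewrite add0m.
move=> dm; have [i mi] : exists i, m1 i != 0%N.
  apply: NNPP => H; move: dm; rewrite mdegE big1 // => i _.
  by apply/eqP/negPn/negP => mi; apply: H; exists i.
rewrite -lep1mP in mi; rewrite -(submK mi) in dm *.
rewrite mdegD mdeg1 addn1 in dm; case: dm => dm.
rewrite -addmA [(U_(i) + m2)%MM]addmC addmA => /stdm_mulX_low lt.
by apply: (IHd _ dm); apply: leq_trans lt (h_low _).
Qed.

Lemma stdm_exists d j : (j < h d)%N ->
  exists m, [/\ mdeg m = d, colex_rank (mnm_seq m) = j & stdm m].
Proof.
move=> lt; have [s [srt sz als rks]] := colex_rank_surj (leq_trans lt (h_nmon d)).
have [m ms] := mnm_seq_surj srt als.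
have dm : mdeg m = d by rewrite -size_mnm_seq ms.
by exists m; rewrite /stdm ms rks dm.
Qed.

Definition lex_ideal p : Prop := forall m, stdm m -> p@_m = 0.

Lemma lex_ideal_homog : homog_ideal lex_ideal.
Proof.
split; first split.
- by move=> m _; rewrite mcoeff0.
- by move=> p q Ip Iq m sm; rewrite mcoeffD Ip ?Iq ?addr0.
- move=> p q Iq m sm; rewrite mcoeffM big1 // => -[m1 m2] /= /eqP E.
  by rewrite Iq ?mulr0 //; apply: (@stdm_dvd m1); rewrite -E.
move=> p d Ip m sm; rewrite /hcomp raddf_sum /= big1 // => m' _.
by rewrite mcoeffZ mcoeffX; case: eqP => [->|_]; rewrite ?(Ip _ sm) ?mul0r ?mulr0.
Qed.

Lemma lex_ideal_hilb d : hilb lex_ideal d (h d).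
Proof.
have /fin_all_exists[e eP] : forall j : 'I_(h d), exists m,
    [/\ mdeg m = d, colex_rank (mnm_seq m) = j & stdm m].
  by move=> j; apply: stdm_exists.
split.
  exists (fun j => 'X_[e j]); split=> [j|c Ic j].
    by rewrite /homog_deg dhomogX /=; have [->] := eP j.
  have [_ rj sj] := eP j; have := Ic _ sj; rewrite raddf_sum (bigD1 j) //= big1.
    by rewrite addr0 mcoeffZ mcoeffX eqxx mulr1.
  move=> l ne; rewrite mcoeffZ mcoeffX; case: eqP => [E|]; last by rewrite mulr0.
  case/negP: ne; apply/eqP/val_inj; rewrite /= -rj.
  by have [_ <- _] := eP l; rewrite E.
move=> f fd ind.
(* With one row more than columns there is a left kernel vector: a combination without standard
   terms. *)
pose M := \matrix_(i < (h d).+1, j < h d) (f i)@_(e j).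
have : (kermx M != 0).
  by rewrite -mxrank_eq0 mxrank_ker -lt0n subn_gt0; apply: leq_ltn_trans (rank_leq_col M) _.
case/rowV0Pn=> c /sub_kermxP cM nz; case/negP: nz; apply/eqP/rowP => i; rewrite mxE.
apply: (ind (fun i => c 0 i)) => m sm; rewrite raddf_sum /=.
have [dm|ndm] := eqVneq (mdeg m) d; last first.
  by rewrite big1 // => j _; rewrite mcoeffZ (dhomog_nemf_coeff (fd j)) ?mulr0.
have lt : (colex_rank (mnm_seq m) < h d)%N by rewrite -dm.
have Em : m = e (Ordinal lt).
  apply: (@mnm_seq_inj r); apply: colex_rank_inj; rewrite ?mnm_seq_sorted ?size_mnm_seq //.
    by have [-> _ _] := eP (Ordinal lt).
  by have [_ -> _] := eP (Ordinal lt).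
have := congr1 (fun A : 'rV_(h d) => A 0 (Ordinal lt)) cM; rewrite !mxE => E; rewrite -[RHS]E.
by apply: eq_bigr => j _; rewrite mcoeffZ !mxE -Em.
Qed.

(** * Failure of the Strong Lefschetz Property for lex-segment ideals *)

Lemma stdm_coef0 d p : homog_deg d p -> (forall m, mdeg m = d -> stdm m -> p@_m = 0) ->
  lex_ideal p.
Proof.
move=> pd H m sm; have [dm|ndm] := eqVneq (mdeg m) d; first exact: H.
exact: dhomog_nemf_coeff pd ndm.
Qed.

(** The [d + 1] monomials of degree [d] in the two smallest variables precede all others. *)
Lemma stdm_two_variables m : (mdeg m < h (mdeg m))%N ->
  (forall j : 'I_r, (1 < j)%N -> m j = 0%N) -> stdm m.
Proof.
move=> lt m0; apply: leq_trans lt;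
suff : (colex_rank (mnm_seq m) < nmon 2 (size (mnm_seq m)))%N by rewrite nmon2 size_mnm_seq.
apply: (colex_rank_lt (mnm_seq_sorted m)); apply/allP => a am.
have ltr := allP (mnm_seq_all m) a am; rewrite ltnNge; apply/negP => lt1.
have := m0 (Ordinal ltr) lt1; rewrite -mnm_seq_count; apply/eqP.
by rewrite -lt0n -has_count has_pred1.
Qed.

Lemma stdm_only_two_variables m : (h (mdeg m) <= mdeg m)%N -> stdm m ->
  forall j : 'I_r, (1 < j)%N -> m j = 0%N.
Proof.
move=> le sm j lt1; apply/eqP; rewrite -mnm_seq_count -leqn0 leqNgt -has_count has_pred1.
move: sm le; rewrite /stdm -size_mnm_seq; have := mnm_seq_sorted m.
case: (mnm_seq m) => //= a s srt sm le; have /andP[B _] := colex_rank_block srt.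
have lta : (a < 2)%N.
  rewrite ltnNge; apply/negP => /(@leq_nmon _ _ (size s).+1); rewrite nmon2.
  by move: B => /=; lia.
have al := allP (order_path_min geq_trans srt).
by rewrite inE negb_or; apply/andP; split; [lia | apply/negP => /al /=; lia].
Qed.

(** A standard monomial of rank exactly [low i.+1 (h i.+1)] has no standard product with a variable,
    so it is a socle element and [L] is not injective. *)
Lemma lex_socle_not_SLP i : (i.+1 < h i.+1)%N -> (low i.+1 (h i.+1) < h i)%N ->
  ~ SLP lex_ideal.
Proof.
move=> lti ltl /(_ 1%N isT)[p [[v pv] pP]].
move: (pP v pv i) => {p pv pP}; rewrite expr1 addn1.
have [m0 [dm0 rm0 sm0]] := stdm_exists ltl.
case=> [inj|surj].
  have Xd : homog_deg i ('X_[m0] : {mpoly k[r]}) by rewrite /homog_deg dhomogX /= dm0.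
  suff /(inj _ Xd)/(_ _ sm0) : lex_ideal (linform v * 'X_[m0]).
    by rewrite mcoeffX eqxx => /eqP; rewrite oner_eq0.
  move=> m sm; rewrite /linform mulr_suml raddf_sum /= big1 // => j _.
  rewrite -scalerAl -mpolyXD mcoeffZ mcoeffX; case: eqP => [E|]; last by rewrite mulr0.
  move: sm; rewrite -E addmC => /stdm_mulX_low; by rewrite rm0 dm0 ltnn.
(* Against surjectivity: evaluation at a nonzero zero [u] of [L], supported on the first two
   coordinates, kills multiples of [L] and the ideal in degree [i + 1], but not every power of a
   variable. *)
pose i0 : 'I_r := ord0; pose i1 : 'I_r := lift ord0 ord0.
have [u [uv unz u0]] : exists u : 'I_r -> k,
    [/\ \sum_j v j * u j = 0, (u i0 != 0) || (u i1 != 0) & forall j : 'I_r, (1 < j)%N -> u j = 0].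
  pose w (a b : k) (j : 'I_r) := if j == i0 then a else if j == i1 then b else 0.
  have wE a b : \sum_j v j * w a b j = v i0 * a + v i1 * b.
    rewrite big_ord_recl big_ord_recl big1 ?addr0 // => j _.
    by rewrite /w /= mulr0.
  have w0 a b (j : 'I_r) : (1 < j)%N -> w a b j = 0.
    by move=> lt; rewrite /w; case: eqP lt => [->|_] //; case: eqP => [->|].
  have [/andP[/eqP v0 /eqP v1]|nz] := boolP ((v i0 == 0) && (v i1 == 0)).
    exists (w 1 0); split; last exact: w0; first by rewrite wE v0 v1 !mul0r addr0.
    by rewrite /w eqxx oner_eq0.
  exists (w (v i1) (- v i0)); split; last exact: w0; first by rewrite wE mulrN mulrC subrr.
  by rewrite /w eqxx /= oppr_eq0 orbC; move: nz; rewrite negb_and.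
have ev0 q : homog_deg i.+1 q -> lex_ideal q -> q.@[u] = 0.
  move=> qd Iq; rewrite mevalE big_seq big1 // => m mq.
  have dm : mdeg m = i.+1 by apply: (dhomog_mf qd).
  have [sm|nsm] := boolP (stdm m); first by rewrite Iq // mul0r.
  have [j [lt1 mj]] : exists j : 'I_r, (1 < j)%N /\ m j <> 0%N.
    apply: NNPP => H; case/negP: nsm; apply: stdm_two_variables; first by rewrite dm.
    by move=> j lt1; apply: NNPP => mj; apply: H; exists j.
  by rewrite (bigD1 j) //= u0 // expr0n; case: eqP mj => // _ _; rewrite mul0r mulr0.
have ev (j : 'I_r) : u j = 0.
  have gd : homog_deg i.+1 ('X_j ^+ i.+1 : {mpoly k[r]}).
    rewrite /homog_deg; have := @dhomogMn _ _ _ 1%N ('X_j : {mpoly k[r]}) i.+1.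
    by rewrite mul1n; apply; rewrite dhomogX /= mdeg1.
  have [f fd If] := surj _ gd.
  have Lf : homog_deg i.+1 (linform v * f).
    rewrite /homog_deg -[i.+1]add1n; apply: dhomogM fd.
    by apply: rpred_sum => l _; apply: rpredZ; rewrite dhomogX /= mdeg1.
  have := ev0 _ (rpredB gd Lf) If; rewrite mevalB mevalM rmorphXn /= mevalXU.
  have -> : (linform v).@[u] = 0.
    by rewrite -uv raddf_sum; apply: eq_bigr => l _; rewrite /= mevalZ mevalXU.
  by rewrite mul0r subr0 => /eqP; rewrite expf_eq0 => /eqP.
by move: unz; rewrite !ev eqxx.
Qed.

(** The standard monomials of degree [t] involve only the first two variables, so no product with
    another variable is standard. *)
Lemma lex_ideal_mul_linear t p f : (h t <= t)%N -> homog_deg t (p * f) -> homog_deg 1 f ->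
  (forall j : 'I_r, (j <= 1)%N -> f@_U_(j) = 0) -> lex_ideal (p * f).
Proof.
move=> ht pfd fd f0; apply: (stdm_coef0 pfd) => m dm sm.
have hm : (h (mdeg m) <= mdeg m)%N by rewrite dm.
rewrite mcoeffM big1 // => -[m1 m2] /= /eqP E.
have [dm2|ndm2] := eqVneq (mdeg m2) 1%N; last first.
  by rewrite (dhomog_nemf_coeff fd) ?mulr0.
have /mdeg1P[j /eqP Ej] : mdeg m2 == 1%N by rewrite dm2.
have [le|lt] := leqP j 1; first by rewrite [m2 : 'X_{1..r}]Ej f0 ?mulr0.
have := congr1 (fun x : 'X_{1..r} => x j) E.
by rewrite /= (stdm_only_two_variables hm sm lt) mnmDE Ej mnm1E eqxx addn1.
Qed.

(** The map from degree 1 to degree [t] has rank at most 2, below both [h 1] and [h t]. *)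
Lemma lex_wide_not_SLP t : (2 < r)%N -> h 1 = r -> (2 < h t <= t)%N -> ~ SLP lex_ideal.
Proof.
move=> r2 h1 /andP[ht3 ht] slp; have t2 : (1 < t)%N by lia.
have [|p [[v pv] /(_ v pv 1%N)]] := slp t.-1; first by lia.
set P := linform v ^+ t.-1; rewrite add1n prednK; last by lia.
have Pf f : homog_deg 1 f -> homog_deg t (P * f).
  move=> fd; have Et : t = (t.-1 + 1)%N by lia.
  rewrite /homog_deg [X in X.-homog for _]Et; apply: dhomogM fd.
  rewrite -[t.-1]mul1n; apply: dhomogMn; apply: rpred_sum => l _.
  by apply: rpredZ; rewrite dhomogX /= mdeg1.
case=> [inj|surj].
  pose i2 : 'I_r := Ordinal r2.
  have Xd : homog_deg 1 ('X_i2 : {mpoly k[r]}) by rewrite /homog_deg dhomogX /= mdeg1.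
  have /(inj _ Xd)/(_ U_(i2)%MM) : lex_ideal (P * 'X_i2).
    apply: (lex_ideal_mul_linear ht (Pf _ Xd) Xd) => j le.
    by rewrite mcoeffXU; case: eqP => // E; move: le; rewrite -E.
  rewrite mcoeffXU eqxx => H; case/eqP: (oner_neq0 k); apply: H.
  rewrite /stdm mdeg1 h1 -[X in (_ < X)%N]nmon_1 -(mdeg1 i2) -size_mnm_seq.
  by apply: colex_rank_lt; rewrite ?mnm_seq_sorted ?mnm_seq_all.
have /fin_all_exists[e eP] : forall j : 'I_3, exists m,
    [/\ mdeg m = t, colex_rank (mnm_seq m) = j & stdm m].
  by move=> j; apply: stdm_exists; apply: leq_trans (ltn_ord j) ht3.
have /fin_all_exists[f fP] : forall j : 'I_3, exists f,
    homog_deg 1 f /\ lex_ideal ('X_[e j] - P * f).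
  move=> j; have [|f fd If] := surj 'X_[e j]; last by exists f.
  by rewrite /homog_deg dhomogX /=; have [->] := eP j.
(* Three preimages have a nontrivial combination free of the first two variables; its product with
   [P] lies in the ideal, a relation among three standard monomials. *)
pose M := \matrix_(j < 3, l < 2) (f j)@_U_(widen_ord (ltnW r2) l).
have : (kermx M != 0).
  by rewrite -mxrank_eq0 mxrank_ker -lt0n subn_gt0; apply: leq_ltn_trans (rank_leq_col M) _.
case/rowV0Pn=> c /sub_kermxP cM nz; case/negP: nz; apply/eqP/rowP => i; rewrite mxE.
pose F := \sum_j c 0 j *: f j.
have Fd : homog_deg 1 F by apply: rpred_sum => j _; apply: rpredZ; case: (fP j).
have IF : lex_ideal (P * F).
  apply: (lex_ideal_mul_linear ht (Pf _ Fd) Fd) => j le.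
  have := congr1 (fun A : 'rV_2 => A 0 (@Ordinal 2 j le)) cM; rewrite !mxE => E; rewrite -[RHS]E.
  rewrite raddf_sum; apply: eq_bigr => l _; rewrite /= mcoeffZ !mxE.
  by congr (_ * mcoeff U_(_) _); apply: val_inj.
have : lex_ideal (\sum_j c 0 j *: 'X_[e j]).
  move=> m sm; have := IF _ sm; rewrite /F mulr_sumr !raddf_sum /= => E.
  rewrite -[RHS]E; apply: eq_bigr => j _; rewrite -scalerAr !mcoeffZ; congr (_ * _).
  by have [_ /(_ _ sm)] := fP j; rewrite mcoeffB => /eqP; rewrite subr_eq0 => /eqP.
have [_ ri si] := eP i; move/(_ _ si); rewrite raddf_sum (bigD1 i) //= big1.
  by rewrite addr0 mcoeffZ mcoeffX eqxx mulr1.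
move=> l ne; rewrite mcoeffZ mcoeffX; case: eqP => [E|]; last by rewrite mulr0.
case/negP: ne; apply/eqP/val_inj; rewrite /= -ri.
by have [_ <- _] := eP l; rewrite E.
Qed.

End LexIdeal.

(** * Multiplication maps on graded algebras *)

(** As [P] need not be decidable, a subspace of maximal dimension inside [P] is taken; a vector of
    [P] outside it would enlarge it. *)
Lemma vspace_of_pred (k : fieldType) (vT : vectType k) (P : vT -> Prop) :
  P 0 -> (forall a u w, P u -> P w -> P (a *: u + w)) ->
  exists V : {vspace vT}, forall u, u \in V <-> P u.
Proof.
move=> P0 Plin; pose T := {V : {vspace vT} | forall u, u \in V -> P u}.
have V0P u : u \in (0 : {vspace vT})%VS -> P u by rewrite memv0 => /eqP ->.
pose V0 : T := exist _ 0%VS V0P.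
have [[V VP] Vmax] := exists_max_nat V0 (fun W : T => dimvS (subvf (sval W))).
exists V => u; split=> [|Pu]; first exact: VP.
have WP w : w \in (<[u]> + V)%VS -> P w.
  by case/memv_addP=> x /vlineP[a ->] [y /VP Py ->]; apply: Plin.
have /= le := Vmax (exist _ _ WP).
have /eqP -> : V == (<[u]> + V)%VS by rewrite eqEdim addvSr le.
by rewrite (subvP (addvSl _ _)) ?memv_line.
Qed.

Section Algebra.
Variables (k : fieldType) (n : nat).
Hypothesis char0 : [pchar k] =i pred0.
Local Notation form := (dhomog n.+1 k).
Local Notation R := {mpoly k[n.+1]}.

Lemma dim_form d : dim (form d) = nmon n.+1 d.
Proof. by rewrite /nmon addSn addnC. Qed.

Variable I : R -> Prop.
Hypothesis homI : homog_ideal I.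

Lemma ideal_lin a p q : I p -> I q -> I (a *: p + q).
Proof. by case: homI => -[_ addI mulI] _ Ip Iq; apply: addI => //; rewrite -mul_mpolyC; apply: mulI. Qed.

Lemma ideal_mul p q : I q -> I (p * q).
Proof. by case: homI => -[_ _ mulI] _; apply: mulI. Qed.

Definition ideal_part d (V : {vspace form d}) : Prop := forall f : form d, f \in V <-> I f.

Lemma ideal_part_exists d c : hilb I d c ->
  exists V : {vspace form d}, ideal_part V /\ codim V = c.
Proof.
move=> [[f [fd find]] nind].
have [||V VP] := @vspace_of_pred k (form d) (fun f => I f).
- by case: homI => -[].
- by move=> a u w; apply: ideal_lin.
exists V; split=> //; apply/eqP; rewrite eqn_leq; apply/andP; split; last first.
  pose g (j : 'I_c) := modv V (to_form d (f j)).
  have fr : free [tuple g j | j < c].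
    apply/freeP => a a0; apply: find.
    pose G : form d := \sum_j a j *: to_form d (f j).
    have <- : G = \sum_j a j *: f j :> R.
      rewrite raddf_sum; apply: eq_bigr => j _; congr (_ *: _).
      exact: (val_to_form (fd j)).
    apply/VP; rewrite -(lker_modv V) memv_ker linear_sum -[X in _ == X]a0; apply/eqP.
    apply: eq_bigr => j _; rewrite linearZ /=; congr (_ *: _).
    by rewrite (nth_map j) ?size_enum_ord // nth_ord_enum.
  have := free_leq_dim fr (U := limg (modv V)).
  rewrite size_tuple => /(_ _); have := limg_ker_dim (modv V) fullv.
  rewrite lker_modv capfv dimvf /codim => E le; rewrite -E addKn; apply: le => x.
  by case/mapP => j _ ->; apply: memv_img (memvf _).
rewrite leqNgt; apply/negP => lt.
(* A larger codimension would give [c + 1] basis vectors of a complement, independent modulo [I]. *)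
have ltX : (c < \dim V^C)%N by rewrite dimv_compl dimvf.
pose X := vbasis V^C.
pose f' (j : 'I_c.+1) : form d := X`_(widen_ord ltX j).
apply: (nind (fun j => f' j : R)) => [j|a Ia j]; first exact: dhomog_is_dhomog.
have sum0 : \sum_j a j *: f' j = 0.
  apply/eqP; rewrite -memv0 -(capv_compl V) memv_cap; apply/andP; split.
    by apply/VP; rewrite raddf_sum; move: Ia; congr I; apply: eq_bigr.
  apply: memv_suml => l _; apply: memvZ; apply/vbasis_mem/mem_nth.
  by rewrite size_tuple ltn_ord.
have := congr1 (coord X (widen_ord ltX j)) sum0.
rewrite linear0 linear_sum (bigD1 j) //= big1 => [|l ne].
  by rewrite linearZ /= coord_free ?(basis_free (vbasisP _)) // eqxx mulr1 addr0.
rewrite linearZ /= coord_free ?(basis_free (vbasisP _)) //.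
by rewrite -(inj_eq val_inj) /=; move: ne; rewrite -val_eqE /= => /negbTE ->; rewrite mulr0.
Qed.

Lemma mult_inj_rank i N v (Vi : {vspace form i}) (V : {vspace form N}) :
  (i <= N)%N -> ideal_part Vi -> ideal_part V ->
  (\dim V + codim Vi <= \dim (powimg V v i))%N -> mult_inj I (linform v ^+ (N - i)) i.
Proof.
move=> leN ViP VP le; set mu := hmul (linform v ^+ (N - i)) i N.
have muE f : mu f = linform v ^+ (N - i) * f :> R.
  by rewrite (val_hmul _ (hmul_homogX _ (linform_homog v))) // subnK.
have sub : (Vi <= mu @^-1: V)%VS.
  by apply/subvP => f /ViP If; rewrite -memv_preim; apply/VP; rewrite muE; apply: ideal_mul.
have E := preim_eq_of_dim sub le.
move=> f fd If; have fE := val_to_form fd.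
rewrite -fE; apply/ViP; rewrite E -memv_preim; apply/VP.
by rewrite muE fE.
Qed.

Lemma mult_surj_full i N v (V : {vspace form N}) :
  (i <= N)%N -> ideal_part V -> powimg V v i = fullv ->
  mult_surj I (linform v ^+ (N - i)) i N.
Proof.
move=> leN VP full g gd.
have : to_form N g \in powimg V v i by rewrite full memvf.
case/memv_addP => x /VP Ix [y /memv_imgP[f _ ->] E].
exists f; first exact: dhomog_is_dhomog.
rewrite -(val_hmul f (hmul_homogX (N - i) (linform_homog v)) (_ : N = (N - i + i)%N)) ?subnK //.
by rewrite -(val_to_form gd) E raddfD /= addrK.
Qed.

Variable h : nat -> nat.
Hypothesis hI : forall d, hilb I d (h d).

Lemma hilb_leq_nmon d : (h d <= nmon n.+1 d)%N.
Proof.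
have [V [_ <-]] := ideal_part_exists (hI d).
by rewrite -dim_form -(dim_codim V) leq_addl.
Qed.

Lemma mult_preim_codim d (V : {vspace form d.+1}) v : ideal_part V ->
  (codim (hmul (linform v) d d.+1 @^-1: V) <= h d)%N.
Proof.
move=> VP; have [W [WP <-]] := ideal_part_exists (hI d); apply/codimS/subvP => f /WP If.
rewrite -memv_preim; apply/VP; rewrite (val_hmul _ (linform_homog v)) //.
exact: ideal_mul.
Qed.

(** Multiplication by [L] splits [h d.+1] into a cokernel, at most [high] by Green's theorem, and an
    image, at most [h d]. *)
Lemma macaulay_bound d : (low d.+1 (h d.+1) <= h d)%N.
Proof.
have [V [VP Vh]] := ideal_part_exists (hI d.+1).
have [v le] := green_hyperplane_restriction char0 V; rewrite Vh in le.
rewrite -(leq_add2r (high d.+1 (h d.+1))) low_high -{1}Vh.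
by rewrite -(codim_preim (hmul (linform v) d d.+1) V) leq_add // mult_preim_codim.
Qed.

Lemma ideal_top e d f : h e = 0%N -> (e <= d)%N -> homog_deg d f -> I f.
Proof.
move=> he led; suff H : forall V : {vspace form d}, ideal_part V -> V = fullv.
  move=> fd; have [V [VP _]] := ideal_part_exists (hI d).
  by rewrite -(val_to_form fd); apply/VP; rewrite (H V VP) memvf.
rewrite -(subnKC led); elim: (d - e)%N => [|j IHj].
  rewrite addn0 => V VP; have [W [WP Wh]] := ideal_part_exists (hI e).
  have -> : V = W by apply/vspaceP => g; apply/idP/idP => [/VP/WP|/WP/VP].
  by apply/eqP; rewrite eqEdim subvf dimvf -(dim_codim W) Wh he addn0 /=.
rewrite addnS => V VP; have [W [WP Wh]] := ideal_part_exists (hI (e + j)).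
apply/eqP; rewrite eqEsubv subvf /= -[fullv]lim1g; apply: limg_X_subP => i g.
rewrite id_lfunE; apply/VP; rewrite (val_hmul _ (X_homog k i)) //.
by apply: ideal_mul; apply/WP; rewrite (IHj W WP) memvf.
Qed.

(** The algebra vanishes from degree [e] on, so a finite intersection of open sets suffices. *)
Lemma SLP_of_bounded e : h e = 0%N ->
  (forall d i, (0 < d)%N -> (i < e)%N -> general (fun v =>
     mult_inj I (linform v ^+ d) i \/ mult_surj I (linform v ^+ d) i (i + d))) ->
  SLP I.
Proof.
move=> he H d d0; apply: general_imp (general_bounded char0 (fun i => H d i d0)) => v Hv i.
have [/Hv //|lei] := ltnP i e; left=> f fd _; exact: ideal_top he lei fd.
Qed.

(** The general rank is at least the minimum of [i + 1] and [h (i + d)], which is maximal rank under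
    either alternative. *)
Lemma general_max_rank d i : (h i <= i.+1)%N || (h (i + d) <= i.+1)%N ->
  general (fun v : 'I_n.+1 -> k =>
     mult_inj I (linform v ^+ d) i \/ mult_surj I (linform v ^+ d) i (i + d)).
Proof.
move=> hyp; have [V [VP Vh]] := ideal_part_exists (hI (i + d)).
have [Vi [ViP Vih]] := ideal_part_exists (hI i).
apply: general_imp (general_powimg char0 V) => v /(_ i (leq_addr d i)) H.
have E : (i + d - i)%N = d by rewrite addKn.
suff [full|le] : powimg V v i = fullv \/ (\dim V + codim Vi <= \dim (powimg V v i))%N.
- by right; rewrite -{1}E; apply: (mult_surj_full (leq_addr d i) VP full).
- by left; rewrite -{1}E; apply: (mult_inj_rank (leq_addr d i) ViP VP le).
case: H => [|le]; first by left.
case/orP: hyp => [hle|hle]; first by right; rewrite Vih; lia.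
left; apply/eqP; rewrite eqEdim subvf dimvf -(dim_codim V) Vh.
by apply: leq_trans le; rewrite leq_add2l.
Qed.

(** Equality in Macaulay's bound turns Green's lower bound for the rank into the dimension of the
    source. *)
Lemma general_inj_step i : low i.+1 (h i.+1) = h i ->
  general (fun v => mult_inj I (linform v) i).
Proof.
move=> E; have [V [VP Vh]] := ideal_part_exists (hI i.+1).
have [Vi [ViP Vih]] := ideal_part_exists (hI i).
have [v0 le0] := green_hyperplane_restriction char0 V.
apply: general_imp (codim_hmul_general V v0) => v /leq_trans/(_ le0) le.
have := @mult_inj_rank i i.+1 v Vi V (leqnSn i) ViP VP.
rewrite subSnn expr1; apply.
rewrite Vih /powimg subSnn expr1 -E -(leq_add2r (high i.+1 (codim V))) -addnA Vh low_high.
rewrite -Vh dim_codim -(dim_codim (V + limg (hmul (linform v) i i.+1))%VS) leq_add2l.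
exact: le.
Qed.

Lemma mult_inj_pow v i d :
  (forall j, (i <= j < i + d)%N -> mult_inj I (linform v) j) ->
  mult_inj I (linform v ^+ d) i.
Proof.
elim: d => [|d IHd] H f fd; first by rewrite expr0 mul1r.
rewrite exprS -mulrA => If; apply: (IHd _ f fd) => [j lej|]; first by apply: H; lia.
apply: (H (d + i)%N) If; first by lia.
by rewrite /homog_deg; apply: dhomogM fd; apply: hmul_homogX (linform_homog v).
Qed.

End Algebra.

(* Hilbert functions that force the Strong Lefschetz Property *)
Local Close Scope ring_scope.

Theorem theorem3p2 (k : fieldType) (r e t : nat) (h : nat -> nat) :
  [pchar k]%R =i pred0 ->
  (2 <= r)%N ->
  (* H is the Hilbert function of some standard graded artinian algebra R/I0 *)
  (exists I0 : {mpoly k[r]} -> Prop, homog_ideal I0 /\ forall d, hilb I0 d (h d)) ->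
  h 0%N = 1%N -> h 1%N = r -> h e.+1 = 0%N ->
  (* t is the smallest integer with h_t <= t *)
  (h t <= t)%N -> (forall s, (s < t)%N -> (s < h s)%N) ->
  ((forall I : {mpoly k[r]} -> Prop,
       homog_ideal I -> (forall d, hilb I d (h d)) -> SLP I)
   <->
   (r = 2%N \/
    [/\ (2 < r)%N, (h t <= 2)%N &
        forall i, (1 <= i < t)%N -> macaulay_mm (h i) i (h i.-1)])).
Proof.
move=> char0 r2 [I0 [homI0 hI0]] h0 h1 he ht hs.
case: r r2 I0 homI0 hI0 h1 => [|[|n]] // _ I0 homI0 hI0 h1.
have h_low := macaulay_bound char0 homI0 hI0.
have h_nmon := hilb_leq_nmon homI0 hI0.
have t2 : (1 < t)%N by case: (t) ht => [|[|]] //; rewrite ?h0 ?h1.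
split=> [allSLP|cond I homI hI].
  have slp := allSLP _ (@lex_ideal_homog k n h h_low) (lex_ideal_hilb k h_nmon).
  have [->|ne2] := eqVneq n 0%N; [by left|right].
  have r3 : (2 < n.+2)%N by rewrite !ltnS lt0n.
  split=> // [|[|i] // /andP[_ ltit]].
    rewrite leqNgt; apply/negP => gt2.
    by apply: (lex_wide_not_SLP (t := t) h_nmon r3 h1 _ slp); rewrite gt2 ht.
  have hi := hs _ ltit; apply/macaulay_mmP => //; first by case: (h i.+1) hi.
  apply/eqP; rewrite eqn_leq h_low andbT leqNgt; apply/negP => lt.
  exact: (lex_socle_not_SLP h_nmon hi lt slp).
apply: (SLP_of_bounded char0 homI hI he) => d i d0 _.
case: cond => [[n0]|[r3 ht2 mac]].
  apply: general_max_rank => //; apply/orP; left.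
  by have := h_nmon i; rewrite {1}n0 nmon2.
(* A value of at least 3 in degree [m + 1 >= 3] would force one in degree [m], since
   [low m.+1 3 = 3]. *)
have h2 m : (t <= m)%N -> (h m <= 2)%N.
  move=> /subnKC <-; elim: (m - t)%N => [|j IHj]; first by rewrite addn0.
  rewrite addnS leqNgt; apply/negP => /(leq_low (t + j).+1).
  by have := @low_small (t + j).+1 3; have := h_low (t + j); lia.
have [ltt|let_] := ltnP (i + d) t; last first.
  apply: general_max_rank => //; apply/orP.
  (* For [i = 0] the bound [i + 1] is only 1, so the source [h 0 = 1] is used instead of the
     target. *)
  by case: (posnP i) => [->|i0]; [left; rewrite h0 | right; have := h2 _ let_; lia].
have inj : general (fun v => forall j, (j < i + d)%N -> mult_inj I (linform v) j).
  apply: general_bounded => // j ltj; apply: (general_inj_step char0 homI hI).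
  apply/esym/macaulay_mmP => //; first by have := hs j.+1; lia.
  by apply: mac; lia.
apply: general_imp inj => v Hv; left; apply: mult_inj_pow => j /andP[_]; exact: Hv.
Qed.
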